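(* Let $\mathcal{P}_0$ be a nonempty convex and weakly compact set of probability measures on $(\mathbb{R},\mathcal{B}(\mathbb{R}))$, let $\mathcal{P}$ be the set of probability measures on $(\mathbb{R}^{\mathbb{N}},\mathcal{B}(\mathbb{R}^{\mathbb{N}}))$ constructed from $\mathcal{P}_0$ as in the context, and let $\{X_i\}_{i\in\mathbb{N}}$ be the canonical (i.i.d. under $\mathcal{P}$) sequence. Assume that $$\lim_{n\to\infty} n\,V(|X_1|\ge n)=0 .$$ Put $\underline{\mu}_n=-\mathbb{E}^{\mathcal{P}}[(-n\vee (-X_1))\wedge n]$ and $\overline{\mu}_n=\mathbb{E}^{\mathcal{P}}[(-n\vee X_1)\wedge n]$ for $n\in\mathbb{N}$. Then for every $\varepsilon>0$, $$\lim_{n\to\infty} v\left(\underline{\mu}_n-\varepsilon\le \frac{\sum_{i=1}^n X_i}{n}\le \overline{\mu}_n+\varepsilon\right)=1 .$$ Furthermore, if the sequences $\{\underline{\mu}_n\}_{n\in\mathbb{N}}$ and $\{\overline{\mu}_n\}_{n\in\mathbb{N}}$ are bounded, then $$\lim_{n\to\infty}\left|\mathbb{E}^{\mathcal{P}}\left[\varphi\left(\frac{\sum_{i=1}^nX_i}{n}\right)\right]-\max_{\underline{\mu}_n\le\mu\le\overline{\mu}_n}\varphi(\mu)\right|=0\qquad\text{for all }\varphi\in C_b(\mathbb{R}).$$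
   Context: $\mathbb{N}=\{1,2,\dots\}$; $a\vee b=\max(a,b)$, $a\wedge b=\min(a,b)$; $C_b(\mathbb{R})$ is the space of bounded continuous real functions on $\mathbb{R}$. ''Weakly compact'' refers to the topology of weak convergence of probability measures (tested against bounded continuous functions). Canonical space: $(\mathbb{R}^{\mathbb{N}},\mathcal{B}(\mathbb{R}^{\mathbb{N}}))$ with canonical random variables $X_i(\omega)=\omega_i$ for $\omega=(\omega_1,\omega_2,\dots)\in\mathbb{R}^{\mathbb{N}}$. Construction of $\mathcal{P}$ from $\mathcal{P}_0$: $\mathcal{P}$ is the set of all probability measures $P$ on $(\mathbb{R}^{\mathbb{N}},\mathcal{B}(\mathbb{R}^{\mathbb{N}}))$ for which there exist $\mu_1\in\mathcal{P}_0$ and, for each $i\ge2$, a probability kernel $\kappa_i$ from $\mathbb{R}^{i-1}$ to $\mathbb{R}$ (i.e. $\kappa_i(x_1,\dots,x_{i-1},\cdot)$ is a probability measure on $(\mathbb{R},\mathcal{B}(\mathbb{R}))$ for every $(x_1,\dots,x_{i-1})\in\mathbb{R}^{i-1}$, and $\kappa_i(\cdot,B)$ is $\mathcal{B}(\mathbb{R}^{i-1})$-measurable for every $B\in\mathcal{B}(\mathbb{R})$) with $\kappa_i(x_1,\dots,x_{i-1},\cdot)\in\mathcal{P}_0$ for all $(x_1,\dots,x_{i-1})$, such that for all $n\ge1$ and all $A\in\mathcal{B}(\mathbb{R}^n)$, $$P(\{\omega:(\omega_1,\dots,\omega_n)\in A\})=\int_{\mathbb{R}}\mu_1(dx_1)\int_{\mathbb{R}}\kappa_2(x_1,dx_2)\cdots\int_{\mathbb{R}}\mathbf{1}_A(x_1,\dots,x_n)\,\kappa_n(x_1,\dots,x_{n-1},dx_n).$$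 The sequence $\{X_i\}$ is then called a canonical i.i.d. sequence under $\mathcal{P}$ (this is terminology, meaning exactly that $\mathcal{P}$ is constructed in this way with the same set $\mathcal{P}_0$ at every step). Sublinear expectation and capacities: $\mathbb{E}^{\mathcal{P}}[X]=\sup_{P\in\mathcal{P}}E_P[X]$ for measurable $X$; $v(A)=\inf_{P\in\mathcal{P}}P(A)$ and $V(A)=\sup_{P\in\mathcal{P}}P(A)$ for $A\in\mathcal{B}(\mathbb{R}^{\mathbb{N}})$. *)

(* Defs.v *)
From HB Require Import structures.
From mathcomp Require Import all_boot all_order all_algebra.
From mathcomp Require Import all_classical all_reals all_analysis.
Import Order.TTheory GRing.Theory Num.Theory.
Import numFieldNormedType.Exports.

Set Implicit Arguments.
Unset Strict Implicit.
Unset Printing Implicit Defensive.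

Local Open Scope classical_set_scope.
Local Open Scope ring_scope.

Definition Cb (R : realType) := {phi : R -> R | continuous phi /\ bounded_fun phi}.

(* The topology of weak convergence: the coarsest one making P |-> \int f dP
   continuous for every f in C_b. *)
Definition weak_probability (R : realType) :=
  initial_topology (fun (P : probability R R) =>
    (fun f : Cb R => \int[P]_x (sval f x)) : {ptws Cb R -> R}).

Definition weakly_compact (R : realType) (P0 : set (probability R R)) :=
  compact (P0 : set (weak_probability R)).

(* A [probability] is a function on all subsets, unconstrained on the
   non-measurable ones: a Borel measure is only identified by its values on
   Borel sets, so membership in a set of probabilities is taken up to them. *)
Definition borel_mem (R : realType) (P0 : set (probability R R))
    (m : set R -> \bar R) :=
  exists2 P : probability R R, P0 P & forall B, measurable B -> P B = m B.

Definition convex_probabilities (R : realType) (P0 : set (probability R R)) :=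
  forall (P Q : probability R R) (t : R), P0 P -> P0 Q -> 0 <= t <= 1 ->
  borel_mem P0 (fun B => t%:E * P B + (1 - t)%:E * Q B)%E.

(* R^N with the Borel sigma-algebra of the product topology. *)
Definition RN (R : realType) := g_sigma_algebraType (@open {ptws nat -> R}).

(* Indices start at 0: [X i] is X_{i+1}. *)
Definition X (R : realType) (i : nat) (omega : RN R) : R := omega i.

(* [iterated_integral mu kappa n f] is
   \int mu(dx_1) \int kappa_2(x_1, dx_2) ...
     \int f(x_1, ..., x_{n+1}) kappa_{n+1}(x_1, ..., x_n, dx_{n+1}),
   where kappa_{i+2} is [kappa i]. *)
Fixpoint iterated_integral (R : realType) (mu : probability R R)
    (kappa : forall i : nat, R.-pker (i.+1.-tuple R) ~> R) (n : nat) :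
    (n.+1.-tuple R -> \bar R) -> \bar R :=
  match n with
  | 0%N => fun f => (\int[mu]_x f [tuple x])%E
  | m.+1 => fun f =>
      iterated_integral mu kappa
        (fun x : m.+1.-tuple R => \int[kappa m x]_y f [tuple of rcons x y])%E
  end.

Definition iid_family (R : realType) (P0 : set (probability R R)) :
    set (probability (RN R) R) :=
  [set P | exists (mu : probability R R)
                  (kappa : forall i : nat, R.-pker (i.+1.-tuple R) ~> R),
    [/\ borel_mem P0 mu,
        forall i x, borel_mem P0 (kappa i x) &
        forall (n : nat) (A : set (n.+1.-tuple R)), measurable A ->
          P [set omega | A [tuple X i omega | i < n.+1]] =
          iterated_integral mu kappa (fun x => (\1_A x)%:E)]].

Section sublinear.
Context (R : realType) (PP : set (probability (RN R) R)).
Local Open Scope ereal_scope.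

Definition sublinear_expectation (Y : RN R -> R) : \bar R :=
  ereal_sup [set 'E_P[Y] | P in PP].

Definition upper_capacity (A : set (RN R)) : \bar R :=
  ereal_sup [set P A | P in PP].

Definition lower_capacity (A : set (RN R)) : \bar R :=
  ereal_inf [set P A | P in PP].

End sublinear.

Definition trunc (R : realType) (n : nat) (x : R) : R :=
  Num.min (Num.max (- n%:R) x) n%:R.

(* The expectations are of bounded variables, hence finite when [PP] is
   nonempty. *)
Definition lower_mean (R : realType) (PP : set (probability (RN R) R))
    (n : nat) : R :=
  - fine (sublinear_expectation PP (fun omega => trunc n (- X 0 omega))).

Definition upper_mean (R : realType) (PP : set (probability (RN R) R))
    (n : nat) : R :=
  fine (sublinear_expectation PP (fun omega => trunc n (X 0 omega))).

Definition sample_mean (R : realType) (n : nat) (omega : RN R) : R :=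
  (\sum_(i < n) X i omega) / n%:R.

Definition is_maximum (R : realType) (A : set R) (m : R) := A m /\ ubound A m.

(* Main.v *)
Require Import Defs.
From HB Require Import structures.
From mathcomp Require Import all_boot all_order all_algebra.
From mathcomp Require Import all_classical all_reals all_analysis.
From mathcomp Require Import measurable_realfun ring lra.
Import Order.TTheory GRing.Theory Num.Theory.
Import numFieldNormedType.Exports.

(** The proof controls the truncated sums by a potential. Fix n, truncate every
    variable at level n, and let [a, b] be the interval from the lower to the
    upper mean, which contains the truncated means of all the laws in P0.
    Whatever kernels are chosen, the conditional mean of each truncated summand
    lies in [a, b]; so, in conditional expectation, one more summand increases
    the squared distance of the partial sum of j terms to [j a, j b] by at most
    a bound C_n on the truncated second moments ([potential_step]). Markov's
    inequality, together with a union bound over the truncated terms, bounds the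
    probability that the sample mean leaves [a - eps, b + eps] by
    n V_n + C_n / (n eps^2), where V_k is the capacity of {k <= |X|}, uniformly
    over the family ([weak_law_bound]). For C_n one can take the sum of the
    (2 k + 1) V_k over k < n, so the hypothesis k V_k --> 0 and Cesaro's lemma make
    this bound vanish ([cvg_deviation_bound]): this is the first claim.

    For the second claim, uniform continuity of phi on a segment containing all
    the mean intervals turns the same bound into an upper estimate of the
    sublinear expectation. For the lower estimate, convexity provides a single
    law in P0 whose truncated mean is close to a maximizer of phi
    ([exists_trunc_mean]); under the product measure with that law at every
    step, the bound applies with a = b and concentrates the sample mean there.

    The second half, and even the fact that the family is nonempty and has every
    law of P0 among its first marginals, requires product measures on the
    sequence space ([iid_family_singleton_neq0]). They are realized on the line
    from one uniform seed: the digits of even rank of the seed and those of odd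
    rank are independent and uniform ([even_odd_digits_law]), so the even ones
    can be turned by a quantile function into a variable with the required law
    while the odd ones serve as the seed for the next variables. *)

Set Implicit Arguments.
Unset Strict Implicit.
Unset Printing Implicit Defensive.

Local Open Scope classical_set_scope.
Local Open Scope ring_scope.

(** * Distribution functions and binary digits of a uniform variable *)

Definition image_prob d d' (T : measurableType d) (T' : measurableType d')
    (R : realType) (P : probability T R) (f : T -> T')
    (mf : measurable_fun [set: T] f) : probability T' R :=
  distribution P (mfun_Sub (mem_set mf)).

Lemma measurable_Iic (R : realType) :
  @measurable _ R = <<s range (fun x : R => `]-oo, x]%classic) >>.
Proof.
apply/seteqP; split.
  rewrite [X in X `<=` _](_ : _ = (RGenOInfty.G (R:=R)).-sigma.-measurable); last first.
    by rewrite -RGenOInfty.measurableE.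
  apply: smallest_sub; first exact: smallest_sigma_algebra.
  move=> _ [x ->]; rewrite -setCitvl.
  by apply: sigma_algebraC; apply: sub_sigma_algebra; exists x.
apply: smallest_sub; first exact: sigma_algebra_measurable.
by move=> _ [x _ <-]; exact: measurable_itv.
Qed.

Lemma measure_unique_Iic (R : realType) (m1 m2 : {measure set R -> \bar R}) :
  (forall x : R, m1 `]-oo, x]%classic = m2 `]-oo, x]%classic) ->
  (forall x : R, (m1 `]-oo, x]%classic < +oo)%E) ->
  forall A, measurable A -> m1 A = m2 A.
Proof.
move=> m12 m1oo; apply: (measure_unique (range (fun x : R => `]-oo, x]%classic))
  (fun n => `]-oo, n%:R]%classic)).
- exact: measurable_Iic.
- move=> _ _ [x _ <-] [y _ <-]; exists (Num.min x y) => //.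
  apply/seteqP; split => z/=; rewrite !in_itv/= le_min; first by move/andP.
  by move=> [-> ->].
- by move=> i; exists i%:R.
- rewrite -subTset => x _; exists (Num.truncn x).+1 => //=.
  by rewrite in_itv/= ltW// truncnS_gt.
- by move=> _ [x _ <-].
- by move=> k.
Qed.

Definition clamp01 (R : realType) (x : R) : R := Num.max 0 (Num.min x 1).

Lemma clamp01E (R : realType) (x : R) :
  clamp01 x = (if x <= 0 then 0 else if x <= 1 then x else 1).
Proof. by rewrite /clamp01 maxEle minEle; do ! case: ifPn; lra. Qed.

Lemma exists_uniform01 (R : realType) :
  exists U : probability R R, forall x, U `]-oo, x]%classic = (clamp01 x)%:E.
Proof.
have mid : @measurable_fun _ _ (measurableTypeR R) R setT idfun.
  exact: measurable_id.
exists (image_prob (uniform_prob (@ltr01 R)) mid) => x.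
rewrite /distribution /pushforward /= /uniform_prob integral_uniform_pdf.
rewrite (eq_integral (cst 1%E)); last first.
  move=> y; rewrite inE/= => -[_]; rewrite in_itv/= /uniform_pdf => ->.
  by rewrite subr0 invr1.
rewrite integral_cst//=; last by apply: measurableI => //; exact: measurable_itv.
rewrite mul1e /clamp01.
rewrite (_ : _ `&` _ = `[0, Num.min x 1]%classic); last first.
  apply/seteqP; split => z/=; rewrite !in_itv/= le_min.
    by move=> [-> /andP[-> ->]].
  by move=> /and3P[-> -> ->].
rewrite lebesgue_measure_itv/= lte_fin.
by case: ltP => //; rewrite -EFinD subr0.
Qed.

(** Both sides are finite measures in A, and half-lines are stable under
    intersection and generate the Borel sets. The set D and the factor k are
    there so that independence of two variables can be passed from half-lines to
    Borel sets one variable at a time. *)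
Lemma law_unique_Iic d (T : measurableType d) (R : realType)
    (m : {measure set T -> \bar R}) (U : probability R R) (D : set T)
    (f : T -> R) (k : R) :
  measurable D -> measurable_fun setT f -> 0 <= k ->
  (forall x, m (D `&` f @^-1` `]-oo, x]%classic) =
             (k%:E * U `]-oo, x]%classic)%E) ->
  forall A, measurable A -> m (D `&` f @^-1` A) = (k%:E * U A)%E.
Proof.
move=> mD mf k0 mU A mA.
have mE B : pushforward (mrestr m mD) f B = m (D `&` f @^-1` B).
  by rewrite /pushforward /mrestr setIC.
rewrite -mE.
apply: (measure_unique_Iic (m1 := pushforward (mrestr m mD) f)
  (m2 := mscale (NngNum k0) U)) => // x; first exact: etrans (mE _) (mU x).
apply: (@le_lt_trans _ _ (k%:E * U `]-oo, x]%classic)%E).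
  by rewrite -mU -mE.
rewrite lte_mul_pinfty ?lee_fin//.
by rewrite (le_lt_trans (probability_le1 _ _)) ?ltry//; exact: measurable_itv.
Qed.

Section doubling.
Variables (R : realType) (U : probability R R).
Hypothesis U_cdf : forall x, U `]-oo, x]%classic = (clamp01 x)%:E.

(** The tie at 1/2 goes to the digit 0: [bit u = 0] is then a closed half-line,
    whose mass is a value of the distribution function. *)
Definition bit (u : R) : R := if 2^-1 < u then 1 else 0.
Definition dbl (u : R) : R := 2 * u - bit u.

Lemma measurable_bit : measurable_fun setT bit.
Proof.
apply: measurable_fun_if => //; first exact: measurable_fun_ltr.
Qed.

Lemma measurable_dbl : measurable_fun setT dbl.
Proof.
apply: measurable_funB; last exact: measurable_bit.
exact: measurable_funM.
Qed.

(** Doubling maps each half of the unit interval affinely onto the whole, so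
    the first binary digit is a fair coin, independent of the shifted digits,
    which are again uniform. *)
Lemma bit_dbl_law (c : bool) B : measurable B ->
  U ([set u | bit u = c%:R] `&` dbl @^-1` B) = ((2^-1)%:E * U B)%E.
Proof.
move=> mB; apply: law_unique_Iic => //.
- rewrite -[X in measurable X]setTI.
  exact: (measurable_bit measurableT (@measurable_set1 _ c%:R)).
- exact: measurable_dbl.
move=> x; rewrite U_cdf.
case: c.
  rewrite (_ : _ `&` _ = `]-oo, (x + 1) / 2] `\` `]-oo, 2^-1])%classic; last first.
    apply/seteqP; split => u/=; rewrite /dbl /bit !in_itv/=.
      case: ifPn => [h [_ ?]|_ [/eqP]]; last by rewrite eq_sym oner_eq0.
      by split; [lra|apply/negP; rewrite -ltNge].
    by move=> [? /negP]; rewrite -ltNge => h; rewrite h; split => //; lra.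
  rewrite measureD//; last first.
    by rewrite (le_lt_trans (probability_le1 _ _)) ?ltry.
  rewrite (_ : _ `&` _ = `]-oo, Num.min ((x + 1) / 2) 2^-1]%classic); last first.
    apply/seteqP; split => u/=; rewrite !in_itv/= le_min; last by move/andP.
    by move=> [-> ->].
  transitivity ((clamp01 ((x + 1) / 2))%:E -
      (clamp01 (Num.min ((x + 1) / 2) 2^-1))%:E)%E.
    by congr (_ - _)%E; exact: U_cdf.
  rewrite -EFinD -EFinM; congr EFin.
  rewrite !clamp01E !minEle; do ! case: ifPn; lra.
rewrite (_ : _ `&` _ = `]-oo, Num.min (x / 2) 2^-1]%classic); last first.
  apply/seteqP; split => u/=; rewrite /dbl /bit !in_itv/= le_min.
    case: ifPn => [h [/eqP]|]; first by rewrite oner_eq0.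
    by rewrite -leNgt => h [_ ?]; apply/andP; split => //; lra.
  by move=> /andP[? h]; rewrite ltNge h/=; split => //; lra.
transitivity (clamp01 (Num.min (x / 2) 2^-1))%:E; first exact: U_cdf.
rewrite -EFinM; congr EFin.
rewrite !clamp01E !minEle; do ! case: ifPn; lra.
Qed.

End doubling.

(** * Splitting a uniform variable into two independent ones *)

Section splitting.
Variable R : realType.
Implicit Types u x y : R.

(** The binary number made of the digits of even rank, in Horner form: the
    recursion is the self-similarity from which the law is computed. *)
Fixpoint even_digits_approx n u : R :=
  if n is m.+1 then (bit u + even_digits_approx m (dbl (dbl u))) / 2 else 0.

Definition even_digits u : R := limn (even_digits_approx ^~ u).
Definition odd_digits u : R := even_digits (dbl u).

Lemma bit_ge0_le1 u : 0 <= bit u <= 1.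
Proof. by rewrite /bit; case: ifPn => _; rewrite ?ler01 ?lexx. Qed.

Lemma even_digits_approx_ge0_le1 n u : 0 <= even_digits_approx n u <= 1.
Proof.
elim: n u => [|n ih] u /=; first by rewrite lexx ler01.
have := bit_ge0_le1 u; have := ih (dbl (dbl u)); lra.
Qed.

Lemma even_digits_approx_nd u : nondecreasing_seq (even_digits_approx ^~ u).
Proof.
apply/nondecreasing_seqP => n; elim: n u => [|n ih] u.
  by have /andP[] := even_digits_approx_ge0_le1 1 u.
rewrite [leLHS]/= [leRHS]/= ler_pM2r// lerD2l; exact: ih.
Qed.

Lemma cvg_even_digits u :
  even_digits_approx n u @[n --> \oo] --> even_digits u.
Proof.
apply: nondecreasing_is_cvgn; first exact: even_digits_approx_nd.
exists 1 => _ [n _ <-]; by have /andP[] := even_digits_approx_ge0_le1 n u.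
Qed.

Lemma even_digits_ge0_le1 u : 0 <= even_digits u <= 1.
Proof.
apply/andP; split.
  apply: limr_ge; first exact: cvg_even_digits.
  by near=> n; have /andP[] := even_digits_approx_ge0_le1 n u.
apply: limr_le; first exact: cvg_even_digits.
by near=> n; have /andP[] := even_digits_approx_ge0_le1 n u.
Unshelve. all: by end_near. Qed.

(** Shifting by one digit exchanges the digits of even and of odd rank. *)
Lemma even_digitsE u : even_digits u = (bit u + odd_digits (dbl u)) / 2.
Proof.
have h1 : even_digits_approx n.+1 u @[n --> \oo] --> even_digits u.
  have := @cvg_even_digits u.
  by rewrite -(cvg_shiftS (even_digits_approx ^~ u)).
have h2 : even_digits_approx n.+1 u @[n --> \oo] -->
    (bit u + odd_digits (dbl u)) / 2.
  rewrite /=; apply: cvgMl; apply: cvgD; first exact: cvg_cst.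
  exact: cvg_even_digits.
exact: (cvg_unique _ h1 h2).
Qed.

Lemma measurable_even_digits : measurable_fun setT even_digits.
Proof.
apply: (measurable_fun_cvg (h := even_digits_approx)); last first.
  by move=> u _; exact: cvg_even_digits.
elim=> [|n ih]; first exact: measurable_cst.
rewrite /=; apply: measurable_funM; last exact: measurable_cst.
apply: measurable_funD; first exact: measurable_bit.
apply: measurableT_comp => //; apply: measurableT_comp => //; exact: measurable_dbl.
Qed.

Lemma measurable_odd_digits : measurable_fun setT odd_digits.
Proof.
by apply: measurableT_comp; [exact: measurable_even_digits|exact: measurable_dbl].
Qed.

Variable U : probability R R.
Hypothesis U_cdf : forall x, U `]-oo, x]%classic = (clamp01 x)%:E.

Lemma bit_split (A : set R) : measurable A ->
  U A = (U ([set u | bit u = true%:R] `&` A) +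
         U ([set u | bit u = false%:R] `&` A))%E.
Proof.
move=> mA; rewrite -measureU//; first last.
- apply/seteqP; split => u //= -[[-> _] [+ _]].
  by move/eqP; rewrite oner_eq0.
- apply: measurableI => //; rewrite -[X in measurable X]setTI.
  exact: (measurable_bit measurableT (@measurable_set1 _ false%:R)).
- apply: measurableI => //; rewrite -[X in measurable X]setTI.
  exact: (measurable_bit measurableT (@measurable_set1 _ true%:R)).
congr (U _); apply/seteqP; split => u /=; last by case=> -[].
by rewrite /bit; case: ifPn => _ ?; [left|right].
Qed.

(** Conditioning on the first digit, for an event A that is described by the
    shifted digits on each of the two halves. *)
Lemma bit_split_dbl (A B1 B0 : set R) : measurable A -> measurable B1 ->
  measurable B0 ->
  (forall u, bit u = 1 -> A u <-> B1 (dbl u)) ->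
  (forall u, bit u = 0 -> A u <-> B0 (dbl u)) ->
  U A = ((2^-1)%:E * U B1 + (2^-1)%:E * U B0)%E.
Proof.
move=> mA mB1 mB0 AB1 AB0; rewrite bit_split//.
rewrite -(bit_dbl_law U_cdf true mB1) -(bit_dbl_law U_cdf false mB0).
by congr (U _ + U _)%E; apply/seteqP; split=> u /= [bu ?]; split=> //;
  [apply/AB1 | apply/AB1 | apply/AB0 | apply/AB0].
Qed.

Lemma dbl_law (B : set R) : measurable B -> U (@dbl R @^-1` B) = U B.
Proof.
move=> mB; rewrite (bit_split_dbl (B1 := B) (B0 := B))//; last first.
  by rewrite -[X in measurable X]setTI; exact: measurable_dbl.
rewrite -ge0_muleDl ?lee_fin// -EFinD (_ : 2^-1 + 2^-1 = 1 :> R) ?mul1e//; lra.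
Qed.

Lemma contraction_eq0 (a : R) : (forall n, `|a| <= (2 ^+ n)^-1) -> a = 0.
Proof.
move=> an; apply/eqP/contraT => a0.
have {}a0 : 0 < `|a| by rewrite normr_gt0.
pose n := (Num.truncn `|a|^-1).+1.
have : `|a|^-1 < 2 ^+ n.
  rewrite (lt_trans (truncnS_gt _))// -natrX ltr_nat; exact: ltn_expl.
by rewrite invf_plt ?posrE// ?exprn_gt0// ltNge an.
Qed.

Let measurable_le (f : R -> R) z : measurable_fun setT f ->
  measurable [set u | f u <= z].
Proof.
move=> mf; have := mf measurableT `]-oo, z]%classic (measurable_itv _).
rewrite setTI; congr measurable; apply/seteqP; split=> u /=; by rewrite in_itv.
Qed.

(* [f] is the distribution function of the even digits, which is also that of
   the odd ones; [F] is the joint distribution function. *)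
Let f x := fine (U [set u | even_digits u <= x]).
Let F x y := fine (U ([set u | even_digits u <= x] `&` [set u | odd_digits u <= y])).

Let fin (A : set R) : measurable A -> U A \is a fin_num.
Proof. by move=> ?; rewrite fin_num_measure. Qed.

Let f_rec x : f x = (f (2 * x) + f (2 * x - 1)) / 2.
Proof.
have mE z := measurable_le z measurable_even_digits.
have mO z := measurable_le z measurable_odd_digits.
have fO z : f z = fine (U [set u | odd_digits u <= z]).
  by rewrite /f -(dbl_law (mE z)).
rewrite [in RHS]fO [f (_ - 1)]fO /f (bit_split_dbl (mE x) (mO (2 * x - 1)) (mO (2 * x))).
- rewrite -(fineK (fin (mO (2 * x)))) -(fineK (fin (mO (2 * x - 1)))).
  rewrite -!EFinM -EFinD /=; lra.
- move=> u bu /=; rewrite even_digitsE bu; split; lra.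
- move=> u bu /=; rewrite even_digitsE bu; split; lra.
Qed.

(* Conditioning on the first digit rescales one coordinate and, because of the
   shift, exchanges the two. *)
Let F_rec x y : F x y = (F y (2 * x) + F y (2 * x - 1)) / 2.
Proof.
have mE z := measurable_le z measurable_even_digits.
have mO z := measurable_le z measurable_odd_digits.
have mF z t := measurableI _ _ (mE z) (mO t).
rewrite /F (bit_split_dbl (mF x y) (mF y (2 * x - 1)) (mF y (2 * x))).
- rewrite -(fineK (fin (mF y (2 * x)))) -(fineK (fin (mF y (2 * x - 1)))).
  rewrite -!EFinM -EFinD /=; lra.
- move=> u bu /=; rewrite even_digitsE {2}/odd_digits bu; split=> -[]; split=> //; lra.
- move=> u bu /=; rewrite even_digitsE {2}/odd_digits bu; split=> -[]; split=> //; lra.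
Qed.

Let f_out x : (x < 0 -> f x = 0) /\ (1 <= x -> f x = 1).
Proof.
split=> x01; rewrite /f.
  rewrite (_ : mkset _ = set0) ?measure0//; apply/seteqP; split => u //=.
  have := even_digits_ge0_le1 u; lra.
rewrite (_ : mkset _ = setT) ?probability_setT//; apply/seteqP; split => u //= _.
have := even_digits_ge0_le1 u; lra.
Qed.

Let F_out x y : (y < 0 -> F x y = 0) /\ (1 <= y -> F x y = f x).
Proof.
split=> x01; rewrite /F /f.
  rewrite (_ : _ `&` _ = set0) ?measure0//; apply/seteqP; split => u //= -[_].
  have := even_digits_ge0_le1 (dbl u); rewrite -/(odd_digits u); lra.
congr (fine (U _)); apply/seteqP; split => u //= => [[]//|]; split=> //.
have := even_digits_ge0_le1 (dbl u); rewrite -/(odd_digits u); lra.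
Qed.

Let clamp_rec x : clamp01 x = (clamp01 (2 * x) + clamp01 (2 * x - 1)) / 2.
Proof. by rewrite !clamp01E; do ! case: ifPn; lra. Qed.

Let clamp_out x : (x <= 0 -> clamp01 x = 0) /\ (1 <= x -> clamp01 x = 1).
Proof. by rewrite !clamp01E; split; do ! case: ifPn; lra. Qed.

Let clamp_itv x : 0 <= clamp01 x <= 1.
Proof. by rewrite !clamp01E; do ! case: ifPn; lra. Qed.

Let fine_itv (A : set R) : measurable A -> 0 <= fine (U A) <= 1.
Proof.
move=> mA; rewrite -!lee_fin fineK ?fin//.
by rewrite measure_ge0/= probability_le1.
Qed.

(* [clamp01] solves the same functional equation as [f]. Of the two terms of the
   recursion at most one falls inside the unit interval, the only place where
   the two functions can differ: each step halves the difference. *)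
Let f_clamp x : f x = clamp01 x.
Proof.
apply/eqP; rewrite -subr_eq0; apply/eqP/contraction_eq0 => n.
elim: n x => [|n ih] x.
  rewrite expr0 invr1 ler_norml.
  have := clamp_itv x.
  have := fine_itv (measurable_le x measurable_even_digits); rewrite -/(f x); lra.
rewrite f_rec clamp_rec exprS invfM.
have [h|h] := ltP (2 * x) 1.
  rewrite (f_out (2 * x - 1)).1 ?(clamp_out (2 * x - 1)).1; [|lra|lra].
  rewrite !addr0 -mulrBl normrM mulrC ger0_norm//.
  by rewrite ler_wpM2l.
rewrite (f_out (2 * x)).2 ?(clamp_out (2 * x)).2//.
rewrite -mulrBl opprD addrACA subrr add0r normrM mulrC ger0_norm//.
by rewrite ler_wpM2l.
Qed.

(* The same contraction argument in the plane; the terms on the boundary of the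
   unit square vanish because the marginals are already known. *)
Let F_clamp x y : F x y = clamp01 x * clamp01 y.
Proof.
apply/eqP; rewrite -subr_eq0; apply/eqP/contraction_eq0 => n.
elim: n x y => [|n ih] x y.
  rewrite expr0 invr1 ler_norml.
  have := clamp_itv x; have := clamp_itv y.
  have mE z := measurable_le z measurable_even_digits.
  have mO z := measurable_le z measurable_odd_digits.
  have := fine_itv (measurableI _ _ (mE x) (mO y)); rewrite -/(F x y); nra.
have {ih} := ih y; rewrite (F_rec x y) (clamp_rec x) exprS invfM => ih.
rewrite [X in `|X|](_ : _ = 2^-1 * ((F y (2 * x) - clamp01 y * clamp01 (2 * x)) +
  (F y (2 * x - 1) - clamp01 y * clamp01 (2 * x - 1)))); last first.
  by field.
rewrite normrM ger0_norm// ler_wpM2l//.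
have [h|h] := ltP (2 * x) 1.
  rewrite (F_out _ (2 * x - 1)).1 ?(clamp_out (2 * x - 1)).1; [|lra|lra].
  by rewrite mulr0 subr0 addr0.
by rewrite (F_out _ (2 * x)).2 ?(clamp_out (2 * x)).2// mulr1 f_clamp subrr add0r.
Qed.

(** The joint distribution function factorizes, and [law_unique_Iic] passes to
    Borel sets in one coordinate and then in the other. *)
Lemma even_odd_digits_law A B : measurable A -> measurable B ->
  U (even_digits @^-1` A `&` odd_digits @^-1` B) = (U A * U B)%E.
Proof.
move=> mA mB.
have mE := measurable_even_digits; have mO := measurable_odd_digits.
have mpre g C : measurable_fun setT g -> measurable C -> measurable (g @^-1` C : set R).
  by move=> mg mC; rewrite -[X in measurable X]setTI; exact: mg.
have preE (g : R -> R) z : g @^-1` `]-oo, z]%classic = [set u | g u <= z].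
  by apply/seteqP; split => u /=; rewrite in_itv.
have UA : U A \is a fin_num by exact: fin.
rewrite -[in RHS](fineK UA); apply: law_unique_Iic => //; [exact: mpre|exact: fine_ge0|].
move=> y; rewrite fineK// setIC [RHS]muleC U_cdf.
apply: law_unique_Iic => //.
- by rewrite preE; exact: measurable_le.
- by have /andP[] := clamp_itv y.
move=> x; rewrite !preE setIC U_cdf -EFinM mulrC -F_clamp fineK//.
by apply: fin; apply: measurableI; exact: measurable_le.
Qed.

End splitting.

(** * The quantile function *)

Section quantile.
Variables (R : realType) (U : probability R R).
Hypothesis U_cdf : forall x, U `]-oo, x]%classic = (clamp01 x)%:E.

(** The point 1 is not an atom. This allows the quantile function to be set
    arbitrarily outside of the open unit interval, where the infimum defining it
    may be taken over an empty or an unbounded set. *)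
Lemma uniform_itv01 (A : set R) : measurable A -> U (A `&` `]0, 1[%classic) = U A.
Proof.
move=> mA.
have m01 : measurable (`]0, 1[%classic : set R) by exact: measurable_itv.
set I01 : set R := `]0, 1[%classic in m01 *.
have UA : U A = (U (A `\` I01) + U (A `&` I01))%E by exact: measureDI.
rewrite [RHS]UA.
rewrite [X in (X + _)%E](_ : _ = 0%E) ?add0e//.
apply/eqP; rewrite eq_le measure_ge0 andbT.
apply/lee_addgt0Pr => e e0; rewrite add0e.
pose J0 : set R := `]-oo, 0]%classic.
pose J1 : set R := `]-oo, 1 - e]%classic.
have mJ0 : measurable J0 by exact: measurable_itv.
have mJ1 : measurable J1 by exact: measurable_itv.
have U0 : U J0 = 0%E by rewrite U_cdf clamp01E lexx.
have U1 : U (~` J1) = (1 - clamp01 (1 - e))%:E.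
  by rewrite EFinB -U_cdf; exact: probability_setC.
apply: (@le_trans _ _ (U (J0 `|` ~` J1))).
  apply: le_measure; rewrite ?inE//.
  - exact: measurableD.
  - by apply: measurableU => //; exact: measurableC.
  move=> x [_]; rewrite /I01 /J0 /J1/= !in_itv/= => h.
  case: (leP x 0) => [|x0]; [by left|right].
  apply/negP; rewrite -ltNge; move/negP : h; rewrite x0/= -leNgt; lra.
apply: (@le_trans _ _ (U J0 + U (~` J1))%E).
  by apply: measureU2 => //; exact: measurableC.
rewrite U0 U1 add0e lee_fin clamp01E; do !case: ifPn; lra.
Qed.

Variable mu : probability R R.

Let idR : {mfun R >-> R} := mfun_Sub (mem_set (@measurable_id _ R setT)).
Let F x := fine (cdf (P := mu) idR x).
Let FE x : cdf (P := mu) idR x = (F x)%:E.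
Proof. by rewrite fineK// fin_num_measure. Qed.

Let F_nd : {homo F : x y / x <= y}.
Proof. by move=> x y xy; rewrite -lee_fin -!FE; exact: cdf_nondecreasing. Qed.

Let F01 x : 0 <= F x <= 1.
Proof. by rewrite -!lee_fin -FE cdf_ge0 cdf_le1. Qed.

Definition quantile u : R := if 0 < u < 1 then inf [set x | u <= F x] else 0.

(* The Galois connection between a distribution function and its quantile
   function; the direct implication is where right-continuity enters. *)
Let quantile_le u x : 0 < u < 1 -> (quantile u <= x) = (u <= F x).
Proof.
move=> u01; rewrite /quantile u01; case/andP: u01 => u0 u1.
have FNy : F x @[x --> -oo] --> (0 : R).
  exact/fine_cvg/(@cvg_cdfNy0 _ _ _ mu idR).
have Fy : F x @[x --> +oo] --> (1 : R).
  exact/fine_cvg/(@cvg_cdfy1 _ _ _ mu idR).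
have [x0 Fx0] := @filter_ex _ _ _ _ (cvgr_lt _ FNy u u0).
have [x1 Fx1] := @filter_ex _ _ _ _ (cvgr_gt _ Fy u u1).
have lb : has_lbound [set x | u <= F x].
  exists x0 => y /= uy; rewrite leNgt; apply/negP => /ltW/F_nd.
  by rewrite leNgt (lt_le_trans Fx0 uy).
have ne : [set x | u <= F x] !=set0 by exists x1; exact: ltW.
apply/idP/idP => h; last exact: ge_inf.
rewrite leNgt; apply/negP => Fxu.
have Fr : F y @[y --> x^'+] --> F x.
  by apply/fine_cvg; rewrite -FE; exact: (@cdf_right_continuous _ _ _ mu idR).
have xnear : \forall y \near x^'+, F y < u /\ x < y.
  exact: filterS2 (cvgr_lt _ Fr u Fxu) (nbhs_right_gt x).
have [y yP] := @filter_ex _ _ (at_right_proper_filter x) _ xnear.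
have [Fyu xy] : F y < u /\ x < y := yP.
have [z /= uz zy] := inf_lt ne (le_lt_trans h xy).
by move: uz; rewrite leNgt (le_lt_trans (F_nd (ltW zy)) Fyu).
Qed.

Lemma measurable_quantile : measurable_fun setT quantile.
Proof.
apply: (measurability _ (@measurable_Iic R)) => _ [_ [x _ <-] <-].
rewrite setTI.
rewrite (_ : _ @^-1` _ = (`]-oo, F x] `&` `]0, 1[) `|`
  (if 0 <= x then ~` `]0, 1[ else set0))%classic; last first.
  apply/seteqP; split => u /=; rewrite !in_itv/=.
    have [u01|u01] := boolP (0 < u < 1); first by rewrite quantile_le//; left.
    rewrite /quantile (negbTE u01) => ->; right => /=.
    by rewrite in_itv/= (negbTE u01).
  case=> [[h u01]|]; first by rewrite quantile_le.
  case: ifPn => // x0 /=; rewrite in_itv/= => /negP u01.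
  by rewrite /quantile (negbTE u01).
have m01 : measurable (`]0, 1[%classic : set R) by exact: measurable_itv.
apply: measurableU; first by apply: measurableI => //; exact: measurable_itv.
by case: ifPn => // _; exact: measurableC.
Qed.

Lemma quantile_law A : measurable A -> U (quantile @^-1` A) = mu A.
Proof.
move=> mA.
rewrite -[RHS]mul1e -[quantile @^-1` A]setTI; apply: law_unique_Iic => //.
  exact: measurable_quantile.
move=> x; rewrite mul1e setTI.
pose B : set R := quantile @^-1` `]-oo, x]%classic.
have mB : measurable B.
  by rewrite -[X in measurable X]setTI; exact: measurable_quantile.
transitivity (U (B `&` `]0, 1[%classic)); first exact: esym (uniform_itv01 mB).
rewrite (_ : B `&` _ = `]-oo, F x]%classic `&` `]0, 1[%classic); last first.
  by apply/seteqP; split => u; rewrite /B/= !in_itv/= => -[h u01]; split=> //;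
    move: h; rewrite quantile_le.
transitivity (U `]-oo, F x]%classic).
  exact: (uniform_itv01 (measurable_itv _)).
transitivity (F x)%:E; last by rewrite -FE.
transitivity (clamp01 (F x))%:E; first exact: U_cdf.
by rewrite clamp01E; congr EFin; have := F01 x; do !case: ifPn; lra.
Qed.

End quantile.

(** * Measurability in the sequence space *)

Section measurable_RN.
Variable R : realType.

(** The filter generated by the sets of sequences that are close to f on the
    first coordinates converges to f pointwise, hence eventually enters A. *)
Lemma open_ptws_ball (A : set {ptws nat -> R}) (f : nat -> R) :
  open A -> A f -> exists n, forall g : nat -> R,
    (forall i, (i < n)%N -> `|g i - f i| < n.+1%:R^-1) -> A g.
Proof.
move=> oA Af.
pose B n : set (nat -> R) :=
  [set g | forall i, (i < n)%N -> `|g i - f i| < n.+1%:R^-1].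
pose F := filter_from setT B.
have FF : Filter F.
  apply: filter_from_filter; first by exists 0%N.
  move=> m n _ _; exists (maxn m n) => // g Bg; split=> i im.
    apply: lt_le_trans (Bg _ (leq_trans im (leq_maxl _ _))) _.
    by rewrite lef_pV2 ?posrE// ler_nat ltnS leq_maxl.
  apply: lt_le_trans (Bg _ (leq_trans im (leq_maxr _ _))) _.
  by rewrite lef_pV2 ?posrE// ler_nat ltnS leq_maxr.
have Ff : {ptws, F --> f}.
  apply/pointwise_cvgP => i; apply/cvgrPdist_lt => e e0.
  exists (maxn i.+1 (Num.truncn e^-1).+1) => // g Bg /=.
  rewrite distrC; apply: lt_le_trans (Bg i (leq_maxl _ _)) _.
  rewrite invf_ple ?posrE// ltW// (lt_le_trans (truncnS_gt _))//.
  by rewrite ler_nat; apply: leqW; rewrite leq_maxr.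
have [n _ nA] : F A by apply: Ff; exact: open_nbhs_nbhs.
by exists n => g gB; exact: nA.
Qed.

(** The Borel sets of the product topology are generated by the coordinates:
    every open set is a countable union of cylinders with rational centres. *)
Lemma measurable_fun_RN d (T : measurableType d) (f : T -> RN R) :
  (forall i, measurable_fun setT (fun t => X i (f t))) -> measurable_fun setT f.
Proof.
move=> mf; apply: (@measurability _ _ T (RN R) setT f (@open {ptws nat -> R})) => //.
move=> _ [A oA <-]; rewrite setTI.
pose C (p : nat * seq rat) : set (nat -> R) := [set g | forall i, (i < p.1)%N ->
  `|g i - ratr (nth 0 p.2 i)| < p.1.+1%:R^-1].
have mC p : measurable (f @^-1` C p).
  rewrite (_ : _ @^-1` _ = \bigcap_(i in [set i | (i < p.1)%N])
     ((fun t => X i (f t)) @^-1` [set y | `|y - ratr (nth 0 p.2 i)| < p.1.+1%:R^-1]))//.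
  apply: bigcap_measurableType => i _.
  rewrite -[X in measurable X]setTI; apply: mf => //.
  rewrite (_ : mkset _ = ball (ratr (nth 0 p.2 i) : R) p.1.+1%:R^-1).
    exact: measurable_ball.
  by apply/seteqP; split => y /=; rewrite /ball/= distrC.
have -> : f @^-1` A = \bigcup_p
    (if pselect (C p `<=` A) then f @^-1` C p else set0).
  apply/seteqP; split => [t At|t [p _]]; last by case: pselect => // pA; exact: pA.
  have [n nA] := open_ptws_ball oA At.
  (* Two radii 1 / (m + 1) add up to 1 / (n + 1). *)
  pose m := n.*2.+1.
  have mn : (m.+1%:R^-1 : R) = n.+1%:R^-1 / 2.
    by rewrite /m -doubleS -muln2 natrM invfM.
  have /choice[q fq] : forall i, exists q : rat, `|f t i - ratr q| < m.+1%:R^-1.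
    move=> i; pose z : R := f t i; rewrite -/z.
    have : 0 < (m.+1%:R^-1 : R) by rewrite invr_gt0.
    move: (m.+1%:R^-1 : R) => a a0.
    have zz : z - a < z + a by lra.
    have [q] := rat_in_itvoo zz.
    rewrite in_itv/= => /andP[q1 q2]; exists q; rewrite ltr_norml; lra.
  exists (m, mkseq q m) => //; case: pselect => /=.
    by move=> _ i im /=; rewrite nth_mkseq.
  case=> g Cg; apply: nA => i /= im.
  have {}im : (i < m)%N by rewrite (leq_trans im)// /m -addnn -addSn leq_addl.
  have := Cg i im; rewrite /= nth_mkseq// => gq; have := fq i.
  rewrite (_ : n.+1%:R^-1 = m.+1%:R^-1 + m.+1%:R^-1); last by rewrite mn -splitr.
  move=> fq'; rewrite -(subrKA (ratr (q i))) (le_lt_trans (ler_normD _ _))//.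
  by rewrite ltrD// distrC.
apply: countable_bigcupT_measurable; first exact: countableP.
by move=> p; case: pselect => ?; [exact: mC|exact: measurable0].
Qed.

Lemma measurable_X i : measurable_fun setT (@X R i).
Proof.
apply: (measurability _ (RGenOpens.measurableE R)) => _ [_ [x [y ->]] <-].
rewrite setTI; apply: sub_sigma_algebra.
apply: (@open_comp {ptws nat -> R} R (@X R i)) => //.
move=> f _; exact: (@proj_continuous nat (fun=> R) i f).
Qed.

End measurable_RN.

(** * Product measures on the sequence space *)

Lemma ge0_integral_law d d' (T : measurableType d) (T' : measurableType d')
    (R : realType) (P : {measure set T -> \bar R}) (Q : {measure set T' -> \bar R})
    (g : T -> T') (h : T' -> \bar R) :
  measurable_fun setT g -> (forall A, measurable A -> P (g @^-1` A) = Q A) ->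
  measurable_fun setT h -> (forall x, 0 <= h x)%E ->
  (\int[P]_t h (g t) = \int[Q]_x h x)%E.
Proof.
move=> mg gQ mh h0.
transitivity (\int[pushforward P g]_x h x)%E.
  by rewrite ge0_integral_pushforward.
by apply: eq_measure_integral => A mA _; exact: gQ.
Qed.

Definition cst_kernel (R : realType) (mu : probability R R) (n : nat) :
    R.-pker (n.+1.-tuple R) ~> R :=
  kprobability (@measurable_cst _ _ (n.+1.-tuple R) (pprobability R R) setT mu).

(** By definition an iterated integral is peeled from its innermost variable.
    With constant kernels the outermost one can be peeled instead, which is what
    the shift of a sequence calls for. *)
Lemma iterated_integral_cons (R : realType) (mu : probability R R) n f :
  iterated_integral mu (cst_kernel mu) (n := n.+1) f =
  (\int[mu]_x iterated_integral mu (cst_kernel mu) (n := n)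
     (fun t => f [tuple of x :: t]))%E.
Proof.
elim: n f => [|n ih] f.
  apply: eq_integral => x _; apply: eq_integral => y _.
  by congr f; apply: val_inj.
rewrite [LHS]ih; apply: eq_integral => x _ /=.
congr iterated_integral; apply/funext => t; apply: eq_integral => y _.
by congr f; apply: val_inj.
Qed.

Section shift.
Variables (R : realType) (U mu : probability R R) (g1 g2 : R -> R).
Hypotheses (mg1 : measurable_fun setT g1) (mg2 : measurable_fun setT g2).
Hypothesis g_law : forall A B, measurable A -> measurable B ->
  U (g1 @^-1` A `&` g2 @^-1` B) = (mu A * U B)%E.

(** As (g1, g2) carries U to the product of mu and U, [g1 u] has law mu and
    [g2 u] is a fresh seed independent of it; iterating g2 draws an i.i.d.
    sequence from a single seed. *)
Definition orbit_seq (u : R) : RN R := fun i => g1 (iter i g2 u).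

Lemma measurable_orbit_seq : measurable_fun setT orbit_seq.
Proof.
apply: measurable_fun_RN => i; rewrite /X /orbit_seq.
apply: measurableT_comp => //; elim: i => [|i ih]; first exact: measurable_id.
exact: measurableT_comp.
Qed.

Let tup n u : n.+1.-tuple R := [tuple X i (orbit_seq u) | i < n.+1].

Let measurable_tup n : measurable_fun setT (tup n).
Proof.
apply/measurable_fun_tnthP => i.
rewrite (_ : _ \o _ = (fun u => X i (orbit_seq u))); last first.
  by apply/funext => u /=; rewrite tnth_mktuple.
apply: measurableT_comp; [exact: measurable_X|exact: measurable_orbit_seq].
Qed.

Let tupS n u : tup n.+1 u = [tuple of g1 u :: tup n (g2 u)].
Proof.
apply: eq_from_tnth => i; rewrite tnth_mktuple.
case: (unliftP ord0 i) => [j ->|->]; last by [].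
by rewrite tnthS tnth_mktuple /X /orbit_seq lift0 iterSr.
Qed.

(** The tail of the orbit of u is the orbit of [g2 u], so Fubini's theorem for the
    law of (g1, g2) splits off the first variable. *)
Lemma integral_orbit_seq n (f : n.+1.-tuple R -> \bar R) :
  measurable_fun setT f -> (forall x, 0 <= f x)%E ->
  (\int[U]_u f (tup n u))%E = iterated_integral mu (cst_kernel mu) (n := n) f.
Proof.
elim: n f => [|n ih] f mf f0.
  rewrite /= -(@ge0_integral_law _ _ _ _ _ U mu g1)//.
  - by apply: eq_integral => u _; congr f; apply: eq_from_tnth => i;
      rewrite tnth_mktuple !ord1.
  - by move=> A mA; rewrite -[LHS]/(U (g1 @^-1` A)) -[g1 @^-1` A]setIT
      -(preimage_setT g2) g_law// probability_setT mule1.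
  - apply: measurableT_comp => //; apply/measurable_fun_tnthP => i.
    by rewrite ord1; exact: measurable_id.
rewrite iterated_integral_cons.
pose h (z : R * R) := f [tuple of z.1 :: tup n z.2].
have mh : measurable_fun setT h.
  apply: measurableT_comp => //; apply: measurable_cons; first exact: measurable_fst.
  by apply: measurableT_comp; [exact: measurable_tup|exact: measurable_snd].
have h0 z : (0 <= h z)%E by exact: f0.
transitivity (\int[U]_u h (g1 u, g2 u))%E.
  by apply: eq_integral => u _; rewrite tupS.
rewrite (@ge0_integral_law _ _ _ _ _ U (mu \x U)%E (fun u => (g1 u, g2 u)))//; last 2 first.
- exact: measurable_fun_pair.
- pose g u := (g1 u, g2 u).
  have mg : measurable_fun setT g by exact: measurable_fun_pair.
  move=> A mA; apply/esym.
  apply: (product_measure_unique (m' := pushforward U g)) => //.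
rewrite fubini_tonelli1//.
apply: eq_integral => x _; rewrite -ih//.
apply: measurableT_comp => //.
by apply: measurable_cons; [exact: measurable_cst|exact: measurable_id].
Qed.

Lemma iid_family_shift : iid_family [set mu] (image_prob U measurable_orbit_seq).
Proof.
exists mu, (cst_kernel mu); split=> [|i x|n A mA].
- by exists mu.
- by exists mu.
rewrite -integral_orbit_seq; last 2 first.
- apply/measurable_EFinP; exact: measurable_indic.
- by move=> x; rewrite lee_fin.
have mtA : measurable (tup n @^-1` A).
  by rewrite -[X in measurable X]setTI; exact: measurable_tup.
transitivity (U (tup n @^-1` A)); first by [].
by rewrite -[in LHS](setIT (tup n @^-1` A)) -integral_indic.
Qed.

End shift.

(** The even digits of a uniform seed feed the quantile function of mu and the
    odd digits are the next seed. *)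
Lemma iid_family_singleton_neq0 (R : realType) (mu : probability R R) :
  iid_family [set mu] !=set0.
Proof.
have [U U_cdf] := exists_uniform01 R.
pose Q := quantile mu.
have mQ : measurable_fun setT Q by exact: measurable_quantile.
have mE := @measurable_even_digits R.
have mO := @measurable_odd_digits R.
have mg1 : measurable_fun setT (Q \o @even_digits R) by exact: measurableT_comp.
have g_law (A B : set R) : measurable A -> measurable B ->
    U ((Q \o @even_digits R) @^-1` A `&` @odd_digits R @^-1` B) = (mu A * U B)%E.
  move=> mA mB.
  have mQA : measurable (Q @^-1` A) by rewrite -[X in measurable X]setTI; exact: mQ.
  by rewrite -(quantile_law U_cdf mu mA) -even_odd_digits_law.
by eexists; exact: (iid_family_shift mg1 mO g_law).
Qed.

(** * Iterated integrals and truncation *)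

(** Comparing the suprema over simple functions gives monotonicity for arbitrary
    nonnegative integrands, such as the layers of an iterated integral. *)
Lemma ge0_le_integral_pointwise d (T : measurableType d) (R : realType)
    (m : {measure set T -> \bar R}) (f g : T -> \bar R) :
  (forall x, 0 <= f x)%E -> (forall x, f x <= g x)%E ->
  (\int[m]_x f x <= \int[m]_x g x)%E.
Proof.
move=> f0 fg; have g0 x : (0 <= g x)%E by exact: le_trans (fg x).
rewrite !ge0_integralTE//.
apply: ge_ereal_sup => _ [h hf <-]; apply: ereal_sup_ubound; exists h => // x.
exact: le_trans (hf x) (fg x).
Qed.

Lemma le_iterated_integral (R : realType) (mu : probability R R) kappa n f g :
  (forall x, 0 <= f x)%E -> (forall x, f x <= g x)%E ->
  (iterated_integral mu kappa (n := n) f <=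
   iterated_integral mu kappa (n := n) g)%E.
Proof.
elim: n f g => [|n ih] f g f0 fg /=; first exact: ge0_le_integral_pointwise.
apply: ih => x; first exact: integral_ge0.
exact: ge0_le_integral_pointwise.
Qed.

Lemma bounded_integrable d (T : measurableType d) (R : realType)
    (P : probability T R) (f : T -> R) (M : R) :
  measurable_fun setT f -> (forall x, `|f x| <= M) ->
  P.-integrable setT (EFin \o f).
Proof.
move=> mf fM; apply: measurable_bounded_integrable => //.
  by apply: (@le_lt_trans _ _ 1%E); [exact: probability_le1|exact: ltry].
exists M; split; first exact: num_real.
by move=> y My x _; exact: le_trans (fM x) (ltW My).
Qed.

Lemma Rintegral_prob_cst d (T : measurableType d) (R : realType)
    (P : probability T R) (r : R) : \int[P]_t (cst r) t = r.
Proof.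
rewrite Rintegral_cst// [fine _](_ : _ = 1) ?mulr1//.
by rewrite -[RHS]/(fine 1%E); congr fine; exact: probability_setT.
Qed.

Lemma measurable_norm_ge (R : realType) (r : R) :
  measurable [set x : R | r <= `|x|].
Proof.
rewrite (_ : mkset _ = (@Num.norm R R) @^-1` `[r, +oo[%classic); last first.
  by apply/seteqP; split => x /=; rewrite in_itv/= andbT.
by rewrite -[X in measurable X]setTI; exact: normr_measurable.
Qed.

Section trunc_lemmas.
Variable R : realType.
Implicit Types x : R.

Lemma truncE N x : trunc N x =
  if x <= - N%:R then - N%:R else if x <= N%:R then x else N%:R.
Proof.
have : 0 <= N%:R :> R by []; rewrite /trunc; move: (N%:R : R) => y y0.
have [h1|h1] := leP (- y) x.
  by have [h2|h2] := leP x y; do !case: ifPn; lra.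
by have [h2|h2] := leP (- y) y; do !case: ifPn; lra.
Qed.

Lemma trunc_norm_le N x : `|trunc N x| <= N%:R.
Proof.
have : 0 <= N%:R :> R by []; rewrite truncE ler_norml; move: (N%:R : R) => y.
by do !case: ifPn; lra.
Qed.

Lemma truncN N x : trunc N (- x) = - trunc N x.
Proof.
have : 0 <= N%:R :> R by []; rewrite !truncE; move: (N%:R : R) => y.
by do !case: ifPn; lra.
Qed.

Lemma trunc_id N x : `|x| < N%:R -> trunc N x = x.
Proof.
rewrite truncE ltr_norml; move: (N%:R : R) => y.
by do !case: ifPn; lra.
Qed.

Lemma measurable_trunc N : measurable_fun setT (@trunc R N).
Proof.
apply: measurable_minr; last exact: measurable_cst.
by apply: measurable_maxr; [exact: measurable_cst|exact: measurable_id].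
Qed.

(** A discrete layer-cake formula: the first N odd numbers add up to N^2. *)
Lemma trunc_sq_le N x :
  trunc N x ^+ 2 <= \sum_(k < N) (2 * k%:R + 1) * (if k%:R <= `|x| then 1 else 0).
Proof.
elim: N => [|N ih].
  by rewrite big_ord0 truncE oppr0; do !case: ifPn; nra.
rewrite big_ord_recr/= (le_trans _ (lerD ih (lexx _)))//.
have : 0 <= N%:R :> R by []; rewrite !truncE -[N.+1%:R]natr1.
move: (N%:R : R) => y y0 {ih}.
have [xy|xy] := leP y `|x|.
  rewrite mulr1; case: ifPn => h1; last case: ifPn => h2; 
    (case: ifPn => h3; last case: ifPn => h4);
  move: xy; rewrite ler_normr => /orP[] xy; nra.
rewrite mulr0 addr0; move: xy; rewrite ltr_norml.
by do !case: ifPn; nra.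
Qed.

End trunc_lemmas.

(** * The deviation bound for adversarial kernels *)

Section potential.
Variables (R : realType) (N : nat) (a b V C K : R).
Hypotheses (V0 : 0 <= V) (K0 : 0 <= K).

(** The distance from s to the segment from [j%:R * a] to [j%:R * b]. *)
Definition excess (j : nat) (s : R) : R :=
  Num.max 0 (Num.max (s - j%:R * b) (j%:R * a - s)).

Definition exceed (x : R) : R := if N%:R <= `|x| then 1 else 0.

(** The two ways in which a sample mean can deviate: some variable is cut by the
    truncation, or the truncated sum is far from where its conditional means can
    bring it. The constant c collects the increments of the variables that have
    already been integrated out. *)
Definition potential (s : seq R) (c : R) : R :=
  \sum_(x <- s) exceed x + K * excess (size s) (\sum_(x <- s) trunc N x) ^+ 2 + c.

Lemma exceed_ge0 x : 0 <= exceed x.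
Proof. by rewrite /exceed; case: ifPn. Qed.

Lemma potential_ge0 s c : 0 <= c -> 0 <= potential s c.
Proof.
move=> c0; apply: addr_ge0 => //; apply: addr_ge0.
  by apply: sumr_ge0 => x _; exact: exceed_ge0.
by apply: mulr_ge0 => //; exact: sqr_ge0.
Qed.

(** Let p be the projection of s on the segment of index j and d = s - p. As p + m
    belongs to the segment of index j + 1, the distance of s + t to the latter is
    at most the absolute value of s + t - (p + m) = d + (t - m). *)
Lemma excessS_le j (s m : R) : a <= m <= b -> exists2 d : R,
  d ^+ 2 = excess j s ^+ 2 &
  forall t, excess j.+1 (s + t) ^+ 2 <= (d + (t - m)) ^+ 2.
Proof.
move=> /andP[am mb]; have j0 : 0 <= j%:R :> R by [].
have jab : j%:R * a <= j%:R * b by rewrite ler_wpM2l// (le_trans am).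
exists (if s > j%:R * b then s - j%:R * b
        else if s < j%:R * a then s - j%:R * a else 0) => [|t].
  rewrite /excess; move: jab; move: (j%:R * a) (j%:R * b) => u v uv.
  case: ifPn => [h|/negP/negP]; last rewrite -leNgt => h.
    by rewrite [Num.max _ (u - s)]max_l ?[Num.max 0 _]max_r//; lra.
  case: ifPn => [h'|/negP/negP]; last rewrite -leNgt => h'.
    by rewrite [Num.max _ (u - s)]max_r ?[Num.max 0 _]max_r ?sqrrB; lra.
  by rewrite [Num.max 0 _]max_l ?ge_max; lra.
set z := _ + (t - m).
rewrite -[leRHS](real_normK (num_real z)) ler_sqr ?nnegrE ?normr_ge0//; last first.
  by rewrite /excess le_max lexx.
rewrite /excess !ge_max normr_ge0/= -[j.+1%:R]natr1 !mulrDl !mul1r /z.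
move: jab; move: (j%:R * a) (j%:R * b) => u v uv; apply/andP; split.
  rewrite (le_trans _ (ler_norm _))//; do !case: ifPn; lra.
rewrite -normrN (le_trans _ (ler_norm _))//; do !case: ifPn; lra.
Qed.

Variable m : probability R R.
Hypotheses (mab : a <= \int[m]_x trunc N x <= b)
  (mV : (m [set x | (N%:R <= `|x|)%R] <= V%:E)%E)
  (mC : \int[m]_x (trunc N x ^+ 2) <= C).

(** In [excessS_le], take for m the mean of the truncated variable: the cross term
    of the square integrates to 0, so integrating out one variable costs at most V
    for the cut and K times the variance, hence K * C, for the distance. *)
Lemma potential_step s c : 0 <= c ->
  (\int[m]_y (potential (rcons s y) c)%:E <= (potential s (c + (V + K * C)))%:E)%E.
Proof.
move=> c0.
pose tbar := \int[m]_x trunc N x.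
have [d dE dP] := excessS_le (size s) (\sum_(x <- s) trunc N x)
  (mab : a <= tbar <= b).
pose A := \sum_(x <- s) exceed x + c.
pose B := d - tbar.
(* The bound of [excessS_le], expanded in powers of the truncated variable. *)
pose g y := (A + K * B ^+ 2) + (exceed y + ((2 * K * B) * trunc N y + K * trunc N y ^+ 2)).
have gP y : potential (rcons s y) c <= g y.
  rewrite /potential /g !big_rcons size_rcons/= /A.
  have := ler_wpM2l K0 (dP (trunc N y)).
  rewrite /B; set e := excess _ _ ^+ 2; set E := \sum_(_ <- _) _.
  rewrite (_ : (d + (trunc N y - tbar)) ^+ 2 =
    (d - tbar) ^+ 2 + 2 * (d - tbar) * trunc N y + trunc N y ^+ 2); last by ring.
  by rewrite !mulrDr; lra.
have me : measurable_fun setT exceed.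
  apply: measurable_fun_if => //=.
  by apply: measurable_fun_ler => //; exact: normr_measurable.
have mt := @measurable_trunc R N.
have ie : m.-integrable setT (EFin \o exceed).
  by apply: (@bounded_integrable _ _ _ _ _ 1) => // x; rewrite /exceed;
    case: ifPn => _; rewrite ?normr1 ?normr0.
have it : m.-integrable setT (EFin \o trunc N).
  by apply: (@bounded_integrable _ _ _ _ _ N%:R) => // x; exact: trunc_norm_le.
have it2 : m.-integrable setT (EFin \o (fun x => trunc N x ^+ 2)).
  apply: (@bounded_integrable _ _ _ _ _ (N%:R ^+ 2)) => [|x].
    exact: measurable_funX.
  by rewrite normrX ler_sqr ?nnegrE ?normr_ge0 ?trunc_norm_le.
have icst k : m.-integrable setT (EFin \o cst k).
  by apply: (@bounded_integrable _ _ _ _ _ `|k|).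
have iZ k f : m.-integrable setT (EFin \o f) ->
    m.-integrable setT (EFin \o (fun x => k * f x)).
  by move=> h; have := integrableZl measurableT k h.
have iD f1 f2 : m.-integrable setT (EFin \o f1) ->
    m.-integrable setT (EFin \o f2) ->
    m.-integrable setT (EFin \o (fun x => f1 x + f2 x)).
  by move=> h1 h2; have := integrableD measurableT h1 h2.
have i1 := iD _ _ (iZ (2 * K * B) _ it) (iZ K _ it2).
have i2 := iD _ _ ie i1.
have ig : m.-integrable setT (EFin \o g) := iD _ _ (icst _) i2.
have gI : \int[m]_y g y = (A + K * B ^+ 2) + (\int[m]_y exceed y +
    ((2 * K * B) * tbar + K * \int[m]_y (trunc N y ^+ 2))).
  rewrite /g (RintegralD measurableT (icst _) i2) (RintegralD measurableT ie i1).
  rewrite (RintegralD measurableT (iZ _ _ it) (iZ _ _ it2)).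
  by rewrite !RintegralZl// -[in RHS](Rintegral_prob_cst m (A + K * B ^+ 2)).
have eE : \int[m]_y exceed y <= V.
  rewrite -lee_fin; apply: le_trans mV.
  have mN := measurable_norm_ge (N%:R : R).
  rewrite /Rintegral fineK; last exact: integrable_fin_num.
  rewrite -[in leRHS](setIT [set x : R | N%:R <= `|x|]) -integral_indic//.
  rewrite le_eqVlt; apply/orP; left; apply/eqP; apply: eq_integral => x _.
  by rewrite /exceed indicE; case: ifPn => h;
    [rewrite mem_set|rewrite memNset//; exact/negP].
apply: (@le_trans _ _ (\int[m]_y (g y)%:E)%E).
  by apply: ge0_le_integral_pointwise => y; rewrite lee_fin ?potential_ge0.
rewrite -[leLHS]fineK ?integrable_fin_num// lee_fin -/(Rintegral m setT g) gI.
rewrite /potential /A -dE.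
have KC := ler_wpM2l K0 mC.
have Kt : 0 <= K * tbar ^+ 2 by rewrite mulr_ge0 ?sqr_ge0.
have KB : K * B ^+ 2 + 2 * K * B * tbar = K * d ^+ 2 - K * tbar ^+ 2.
  by rewrite /B; ring.
lra.
Qed.
End potential.

Section weak_law_bound.
Variables (R : realType) (P0 : set (probability R R)) (k : nat) (a b V C eps : R).
Local Notation N := k.+1.
Hypotheses (V0 : 0 <= V) (C0 : 0 <= C) (eps0 : 0 < eps).
Hypotheses
  (mab : forall m : probability R R, P0 m -> a <= \int[m]_x trunc N x <= b)
  (mV : forall m : probability R R, P0 m ->
    (m [set x | (N%:R <= `|x|)%R] <= V%:E)%E)
  (mC : forall m : probability R R, P0 m -> \int[m]_x (trunc N x ^+ 2) <= C).

(* The deviation of the sample mean by eps makes the distance at least N eps;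
   with this weight the potential is then at least 1. *)
Let K := ((N%:R * eps) ^+ 2)^-1.
Let K0 : 0 <= K. Proof. by rewrite invr_ge0 sqr_ge0. Qed.

Let step (m : {measure set R -> \bar R}) s c : borel_mem P0 m -> 0 <= c ->
  (\int[m]_y (potential N a b K (rcons s y) c)%:E <=
   (potential N a b K s (c + (V + K * C)))%:E)%E.
Proof.
move=> [Q P0Q Qm] c0; rewrite (eq_measure_integral Q); last first.
  by move=> A mA _; exact/esym/Qm.
by apply: potential_step => //; [exact: mab|exact: mV|exact: mC].
Qed.

Let iterated_potential (mu : probability R R)
    (kappa : forall i : nat, R.-pker (i.+1.-tuple R) ~> R) n c : borel_mem P0 mu ->
  (forall i x, borel_mem P0 (kappa i x)) -> 0 <= c ->
  (iterated_integral mu kappa (n := n) (fun t => (potential N a b K t c)%:E) <=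
   (c + n.+1%:R * (V + K * C))%:E)%E.
Proof.
move=> Pmu Pk; have VC0 : 0 <= V + K * C by rewrite addr_ge0// mulr_ge0.
elim: n c => [|n ih] c c0.
  apply: le_trans (step [::] Pmu c0) _.
  rewrite /potential !big_nil /excess/= !mul0r !subr0 !maxxx expr0n mulr0 !add0r.
  by rewrite mul1r.
have -> : c + n.+2%:R * (V + K * C) = (c + (V + K * C)) + n.+1%:R * (V + K * C).
  by rewrite -[n.+2%:R]natr1; ring.
apply: le_trans (ih _ _); last by rewrite addr_ge0.
apply: le_iterated_integral => t.
  by apply: integral_ge0 => y _; rewrite lee_fin potential_ge0.
exact: step.
Qed.

(** Integrating out the N variables, the last one first, leaves only the
    accumulated constant N (V + K C). *)
Lemma weak_law_bound P : iid_family P0 P ->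
  (P [set omega | ~~ (a - eps <= sample_mean N omega <= b + eps)%R] <=
   (N%:R * V + C / (N%:R * eps ^+ 2))%:E)%E.
Proof.
move=> [mu [kappa [Pmu Pk PE]]].
pose mean (t : N.-tuple R) := (\sum_(i < N) tnth t i) / N%:R.
pose A := [set t | ~~ (a - eps <= mean t <= b + eps)].
have mmean : measurable_fun setT mean.
  apply: measurable_funM => //; apply: measurable_sum => i.
  exact: measurable_tnth.
have mA : measurable A.
  rewrite (_ : A = ~` (mean @^-1` `[a - eps, b + eps]%classic)).
    by apply: measurableC; rewrite -[X in measurable X]setTI; exact: mmean.
  by apply/seteqP; split=> t; rewrite /A /= in_itv/= => /negP.
have meanE omega : mean [tuple X i omega | i < N] = sample_mean N omega.
  by congr (_ / _); apply: eq_bigr => i _; rewrite tnth_mktuple.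
have AE : [set omega | ~~ (a - eps <= sample_mean N omega <= b + eps)] =
    [set omega | A [tuple X i omega | i < N]].
  by apply/seteqP; split => omega; rewrite /A /= meanE.
rewrite AE PE//.
have -> : N%:R * V + C / (N%:R * eps ^+ 2) = 0 + N%:R * (V + K * C).
  have y0 : (N%:R : R) != 0 by rewrite pnatr_eq0.
  by rewrite /K; move: (N%:R : R) y0 => y y0; field; rewrite y0 gt_eqF.
apply: (le_trans _ (iterated_potential k Pmu Pk (lexx 0))).
apply: le_iterated_integral => t; first by rewrite lee_fin.
rewrite lee_fin indicE.
have [tA|_] := boolP (t \in A); last exact: potential_ge0.
rewrite /potential addr0 size_tuple.
have sumx0 : 0 <= \sum_(x <- t) exceed N x by apply: sumr_ge0 => x _; exact: exceed_ge0.
have Kx0 : 0 <= K * excess a b N (\sum_(x <- t) trunc N x) ^+ 2.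
  by rewrite mulr_ge0// sqr_ge0.
have [/hasP[x xt xN]|/hasPn tN] := boolP (has (fun x => N%:R <= `|x|) t).
  apply: (@le_trans _ _ (\sum_(x <- t) exceed N x)); last by rewrite lerDl.
  rewrite (big_rem x)//= [X in X + _](_ : _ = 1); last by rewrite /exceed xN.
  by rewrite lerDl; apply: sumr_ge0 => y _; exact: exceed_ge0.
apply: (@le_trans _ _ (K * excess a b N (\sum_(x <- t) trunc N x) ^+ 2));
  last by rewrite lerDr.
have -> : \sum_(x <- t) trunc N x = N%:R * mean t.
  rewrite /mean mulrCA mulfV ?pnatr_eq0// mulr1 -(big_tuple _ _ t xpredT id).
  by apply: eq_big_seq => x /tN; rewrite -ltNge => /trunc_id.
rewrite /K mulrC ler_pdivlMr ?exprn_gt0 ?mulr_gt0// mul1r.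
rewrite ler_sqr ?nnegrE; last 2 first.
- by rewrite mulr_ge0// ltW.
- by rewrite /excess le_max lexx.
rewrite /excess !le_max -!mulrBr !ler_pM2l//.
move: tA; rewrite inE /A /= => /nandP[] h; apply/or3P.
  by apply: Or33; lra.
by apply: Or32; lra.
Qed.

End weak_law_bound.

(** * Convergence and uniform continuity *)

Lemma near_le_cvge (R : realType) (u : (\bar R)^nat) (l : R) :
  (forall e : R, 0 < e -> \forall n \near \oo,
    ((l - e)%:E <= u n <= (l + e)%:E)%E) -> u @ \oo --> l%:E.
Proof.
move=> ul.
have ufin : \forall n \near \oo, u n \is a fin_num.
  apply: filterS (ul 1 ltr01) => n /andP[lu ur].
  by rewrite fin_numElt (lt_le_trans (ltNyr _) lu) (le_lt_trans ur (ltry _)).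
apply/fine_cvgP; split => //; apply/cvgrPdist_le => e e0.
apply: filterS2 ufin (ul e e0) => n un; rewrite -{1 2}(fineK un) !lee_fin /=.
by rewrite ler_distlC.
Qed.

(** Heine's theorem, with only one of the two points required to lie in the
    segment, as the sample mean may be slightly outside of it. *)
Lemma segment_unif_continuous (R : realType) (phi : R -> R) (A B eta : R) :
  continuous phi -> 0 < eta -> exists2 d : R, 0 < d &
    forall x y, A <= x <= B -> `|x - y| <= d -> `|phi x - phi y| <= eta.
Proof.
move=> cphi eta0.
have PF := at_right_proper_filter (0 : R).
have /compact_near_coveringP := @segment_compact R A B.
move=> /(_ R 0^'+ (fun d x => forall y, `|x - y| <= d -> `|phi x - phi y| <= eta)
  (@filter_filter _ _ PF)) nearP.
have near_phi (x : R) : `[A, B]%classic x -> \forall x' \near x & d \near 0^'+,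
    forall y, `|x' - y| <= d -> `|phi x' - phi y| <= eta.
  move=> _.
  have eta2 : 0 < eta / 2 by rewrite divr_gt0.
  have := cphi x; move/cvgrPdist_lt => /(_ _ eta2)/nbhs_ballP[r /= r0 rP].
  have r2 : 0 < r / 2 by rewrite divr_gt0.
  exists (ball x (r / 2), [set d | d < r / 2]) => /=.
    split; first exact: nbhsx_ballx.
    exact: nbhs_right_lt.
  move=> [z d] /= [xz dr] y zy.
  have h1 : `|phi x - phi z| < eta / 2.
    by apply: rP; rewrite /ball/= in xz *; lra.
  have h2 : `|phi x - phi y| < eta / 2.
    apply: rP; rewrite /ball/= in xz *.
    rewrite -(subrKA z) (le_lt_trans (ler_normD _ _))//; lra.
  rewrite -(subrKA (phi x)) (le_trans (ler_normD _ _))// distrC; lra.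
have [d [d0 dP]] := @filter_ex _ _ PF _ (filterI (nbhs_right_gt 0) (nearP near_phi)).
by exists d => // x y xAB; apply: dP; rewrite /= in_itv.
Qed.

(** * First marginals and truncated means *)

Section marginals.
Variable R : realType.

Lemma iid_family_sub (P0 Q0 : set (probability R R)) :
  Q0 `<=` P0 -> iid_family Q0 `<=` iid_family P0.
Proof.
move=> Q0P0 P [mu [kappa [[Q Q0Q Qmu] kP PE]]]; exists mu, kappa; split => //.
  by exists Q => //; exact: Q0P0.
by move=> i x; have [Q' Q0Q' Q'k] := kP i x; exists Q' => //; exact: Q0P0.
Qed.

Lemma iid_family_X0 (P0 : set (probability R R)) P : iid_family P0 P ->
  exists2 m : probability R R, P0 m &
  forall B, measurable B -> P (X 0 @^-1` B) = m B.
Proof.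
move=> [mu [kappa [[Q P0Q Qmu] kP PE]]]; exists Q => // B mB.
have mA : measurable [set t : 1.-tuple R | B (tnth t ord0)].
  rewrite (_ : mkset _ = (fun t : 1.-tuple R => tnth t ord0) @^-1` B)//.
  by rewrite -[X in measurable X]setTI; exact: measurable_tnth.
have := PE 0%N _ mA.
rewrite (_ : mkset _ = X 0 @^-1` B); last first.
  by apply/seteqP; split => omega /=; rewrite tnth_mktuple.
move=> ->; rewrite /= Qmu//.
rewrite -[in RHS](setIT B) -integral_indic//; apply: eq_integral.
Qed.

(** Product measures realize every law of P0 as a first marginal; hence a supremum
    over the family of a quantity depending on the first variable only is a
    supremum over P0. *)
Lemma exists_iid_X0 (P0 : set (probability R R)) m : P0 m ->
  exists2 P, iid_family P0 P &
  forall B, measurable B -> P (X 0 @^-1` B) = m B.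
Proof.
move=> P0m; have [P Pm] := iid_family_singleton_neq0 m.
exists P; first by apply: iid_family_sub Pm => _ ->.
move=> B mB; have [m' -> m'P] := iid_family_X0 Pm.
exact: m'P.
Qed.

End marginals.

Section means.
Variables (R : realType) (P0 : set (probability R R)).
Hypothesis P0_neq0 : P0 !=set0.

Lemma expectation_X0 (P : probability (RN R) R) (m : probability R R)
    (g : R -> R) M :
  (forall B, measurable B -> P (X 0 @^-1` B) = m B) ->
  measurable_fun setT g -> (forall x, `|g x| <= M) ->
  ('E_P[(fun omega => g (X 0 omega))] = (\int[m]_x g x)%:E)%E.
Proof.
move=> Pm mg gM; rewrite unlock.
have mX0 := @measurable_X R 0.
have mgE : measurable_fun setT (EFin \o g) by exact/measurable_EFinP.
transitivity (\int[pushforward P (@X R 0)]_x (g x)%:E)%E.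
  rewrite integral_pushforward//.
  by apply: (@bounded_integrable _ _ _ _ _ M) => //; exact: measurableT_comp.
rewrite (eq_measure_integral m); last by move=> A mA _; exact: Pm.
by rewrite /Rintegral fineK// integrable_fin_num//; exact: bounded_integrable gM.
Qed.

Lemma Rintegral_norm_le (m : probability R R) (g : R -> R) M :
  measurable_fun setT g -> (forall x, `|g x| <= M) -> `|\int[m]_x g x| <= M.
Proof.
move=> mg gM; have ig := bounded_integrable m mg gM.
apply: le_trans (le_normr_Rintegral measurableT ig) _.
apply: (@le_trans _ _ (\int[m]_x (cst M) x)).
  apply: le_Rintegral => //.
  - apply: (@bounded_integrable _ _ _ m _ M) => [|x]; last by rewrite normr_id.
    exact: measurableT_comp.
  - by apply: (@bounded_integrable _ _ _ m _ `|M|).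
by rewrite Rintegral_prob_cst.
Qed.

Lemma sublinear_expectation_X0 (g : R -> R) M :
  measurable_fun setT g -> (forall x, `|g x| <= M) ->
  let e := fine (sublinear_expectation (iid_family P0) (fun omega => g (X 0 omega))) in
  (forall m, P0 m -> \int[m]_x g x <= e) /\
  (forall d, 0 < d -> exists2 m, P0 m & e - d < \int[m]_x g x).
Proof.
move=> mg gM e.
have E : sublinear_expectation (iid_family P0) (fun omega => g (X 0 omega)) =
    ereal_sup [set (\int[m]_x g x)%:E | m in P0].
  congr ereal_sup; apply/seteqP; split => z /=.
    move=> [P /iid_family_X0[m P0m Pm] <-]; exists m => //.
    by rewrite (expectation_X0 Pm mg gM).
  move=> [m /exists_iid_X0[P PP Pm] <-]; exists P => //.
  exact: expectation_X0 Pm mg gM.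
have [m0 P0m0] := P0_neq0.
have Efin : ereal_sup [set (\int[m]_x g x)%:E | m in P0] = e%:E.
  rewrite /e E fineK// fin_numElt; apply/andP; split.
    apply: (@lt_le_trans _ _ (\int[m0]_x g x)%:E); first exact: ltNyr.
    by apply: ereal_sup_ubound; exists m0.
  apply: (@le_lt_trans _ _ M%:E); last exact: ltry.
  apply: ge_ereal_sup => _ [m P0m <-]; rewrite lee_fin.
  by rewrite (le_trans (ler_norm _))// Rintegral_norm_le.
split=> [m P0m|d d0].
  by rewrite -lee_fin -Efin; apply: ereal_sup_ubound; exists m.
have : ((e - d)%:E < ereal_sup [set (\int[m]_x g x)%:E | m in P0])%E.
  by rewrite Efin lte_fin ltrBlDr ltrDl.
by move=> /ereal_sup_gt[_ [m P0m <-]]; rewrite lte_fin => h; exists m.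
Qed.

Lemma Rintegral_truncN n (m : probability R R) :
  \int[m]_x trunc n (- x) = - \int[m]_x trunc n x.
Proof.
rewrite -[RHS]mulN1r -RintegralZl//.
  by apply: eq_Rintegral => x _; rewrite truncN mulN1r.
exact: bounded_integrable (@measurable_trunc R n) (trunc_norm_le n).
Qed.

Let measurable_truncN n : measurable_fun setT (fun x : R => trunc n (- x)).
Proof.
apply: (measurableT_comp (@measurable_trunc R n)); exact: oppr_measurable.
Qed.

Lemma trunc_mean_bounds n m : P0 m ->
  lower_mean (iid_family P0) n <= \int[m]_x trunc n x <= upper_mean (iid_family P0) n.
Proof.
move=> P0m.
have [/(_ m P0m) hu _] :=
  sublinear_expectation_X0 (@measurable_trunc R n) (trunc_norm_le n).
have [/(_ m P0m) hl _] :=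
  sublinear_expectation_X0 (@measurable_truncN n) (fun x => trunc_norm_le n (- x)).
by rewrite hu andbT /lower_mean lerNl -Rintegral_truncN.
Qed.

Lemma lower_le_upper_mean n :
  lower_mean (iid_family P0) n <= upper_mean (iid_family P0) n.
Proof.
by have [m P0m] := P0_neq0; have /andP[] := trunc_mean_bounds n P0m; exact: le_trans.
Qed.

Lemma exists_near_upper_mean n d : 0 < d -> exists2 m, P0 m &
  upper_mean (iid_family P0) n - d < \int[m]_x trunc n x.
Proof.
have [_] := sublinear_expectation_X0 (@measurable_trunc R n) (trunc_norm_le n).
exact.
Qed.

Lemma exists_near_lower_mean n d : 0 < d -> exists2 m, P0 m &
  \int[m]_x trunc n x < lower_mean (iid_family P0) n + d.
Proof.
move=> d0; have [_ /(_ d d0)[m P0m]] :=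
  sublinear_expectation_X0 (@measurable_truncN n) (fun x => trunc_norm_le n (- x)).
rewrite Rintegral_truncN => h; exists m => //.
by rewrite /lower_mean -ltrN2 opprD opprK.
Qed.

Hypothesis P0_convex : convex_probabilities P0.

(** Two laws that nearly attain the extreme means either are close enough to c, or
    have c between their means, and then a convex combination has mean c. *)
Lemma exists_trunc_mean n c d : 0 < d ->
  lower_mean (iid_family P0) n <= c <= upper_mean (iid_family P0) n ->
  exists2 m, P0 m & `|\int[m]_x trunc n x - c| <= d.
Proof.
move=> d0 /andP[lc cu].
have [m1 P0m1 m1u] := exists_near_upper_mean n d0.
have [m2 P0m2 m2l] := exists_near_lower_mean n d0.
have /andP[_ m1u'] := trunc_mean_bounds n P0m1.
have /andP[m2l' _] := trunc_mean_bounds n P0m2.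
set e1 := (\int[m1]_x trunc n x) in m1u m1u'.
set e2 := (\int[m2]_x trunc n x) in m2l m2l'.
have [ce1|e1c] := ltP c e1; last by exists m1 => //; rewrite -/e1 ler_norml; lra.
have [e2c|ce2] := ltP e2 c; last by exists m2 => //; rewrite -/e2 ler_norml; lra.
have e21 : 0 < e1 - e2 by lra.
pose t := (c - e2) / (e1 - e2).
have t01 : 0 <= t <= 1.
  by rewrite divr_ge0 ?ler_pdivrMr ?mul1r//=; lra.
have [m P0m mE] := P0_convex P0m1 P0m2 t01.
exists m => //; rewrite (_ : \int[m]_x trunc n x = c) ?subrr ?normr0 ?ltW//.
have mt := @measurable_trunc R n; have tn := @trunc_norm_le R n.
have it (p : probability R R) := bounded_integrable p mt tn.
have [t0 t1] : 0 <= t /\ 0 <= 1 - t by lra.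
pose mm := measure_add (mscale (NngNum t0) m1) (mscale (NngNum t1) m2).
(* Adding n makes the truncated variable nonnegative, so that its integral is
   linear in the measure. *)
have hE (p : probability R R) :
    (\int[p]_x (trunc n x + n%:R)%:E = (\int[p]_x trunc n x + n%:R)%:E)%E.
  have icst : p.-integrable setT (EFin \o cst (n%:R : R)).
    by apply: (@bounded_integrable _ _ _ p _ `|n%:R|).
  transitivity (\int[p]_x (trunc n x + n%:R))%:E.
    rewrite /Rintegral fineK// integrable_fin_num//.
    exact: (integrableD measurableT (it p) icst).
  by rewrite (RintegralD measurableT (it p) icst) Rintegral_prob_cst.
have h0 (x : R) : (0 <= (trunc n x + n%:R)%:E)%E.
  by rewrite lee_fin; have := tn x; rewrite ler_norml; lra.
have mh : measurable_fun setT (fun x : R => (trunc n x + n%:R)%:E).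
  by apply/measurable_EFinP; apply: measurable_funD.
have : (\int[m]_x (trunc n x + n%:R)%:E = \int[mm]_x (trunc n x + n%:R)%:E)%E.
  by apply: eq_measure_integral => A mA _; rewrite [RHS]measure_addE; exact: mE.
rewrite /mm ge0_integral_measure_add// !ge0_integral_mscale// !hE/= -!EFinM -EFinD.
move=> [] h; have -> : \int[m]_x trunc n x = t * e1 + (1 - t) * e2.
  by apply: (addIr n%:R); rewrite h /e1 /e2; ring.
by rewrite /t; field; rewrite gt_eqF.
Qed.

End means.

(** * Capacities of the tails *)

Section tails.
Variables (R : realType) (P0 : set (probability R R)).
Hypothesis P0_neq0 : P0 !=set0.

Definition tail_capacity (k : nat) : R :=
  fine (upper_capacity (iid_family P0) [set omega | k%:R <= `|X 0 omega|]).

(** The bound on second moments given by [trunc_sq_le]. *)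
Definition moment_bound (n : nat) : R :=
  \sum_(k < n) (2 * k%:R + 1) * tail_capacity k.

Definition deviation_bound (eps : R) (n : nat) : R :=
  n%:R * tail_capacity n + moment_bound n / (n%:R * eps ^+ 2).

Lemma tail_capacityE k :
  upper_capacity (iid_family P0) [set omega | k%:R <= `|X 0 omega|] =
  (tail_capacity k)%:E.
Proof.
rewrite /tail_capacity fineK// fin_numElt; have [m0 P0m0] := P0_neq0.
have [P PP _] := exists_iid_X0 P0m0.
apply/andP; split.
  apply: (@lt_le_trans _ _ (P [set omega | k%:R <= `|X 0 omega|])).
    exact: lt_le_trans (ltNyr 0) (measure_ge0 _ _).
  by apply: ereal_sup_ubound; exists P.
apply: (@le_lt_trans _ _ 1%E); last exact: ltry.
apply: ge_ereal_sup => _ [Q QQ <-]; apply: probability_le1.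
rewrite (_ : mkset _ = X 0 @^-1` [set x : R | k%:R <= `|x|])//.
by rewrite -[X in measurable X]setTI; apply: measurable_X => //;
  exact: measurable_norm_ge.
Qed.

Lemma tail_capacity_ge m k : P0 m ->
  (m [set x | (k%:R <= `|x|)%R] <= (tail_capacity k)%:E)%E.
Proof.
move=> /exists_iid_X0[P PP Pm]; rewrite -Pm; last exact: measurable_norm_ge.
rewrite -tail_capacityE.
by apply: ereal_sup_ubound; exists P.
Qed.

Lemma tail_capacity_ge0 k : 0 <= tail_capacity k.
Proof.
have [m P0m] := P0_neq0.
by rewrite -lee_fin (le_trans _ (tail_capacity_ge k P0m)).
Qed.

Lemma moment_bound_ge0 n : 0 <= moment_bound n.
Proof.
by apply: sumr_ge0 => k _; rewrite mulr_ge0 ?tail_capacity_ge0// addr_ge0 ?mulr_ge0.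
Qed.

Lemma second_moment_le m n : P0 m ->
  \int[m]_x (trunc n x ^+ 2) <= moment_bound n.
Proof.
move=> P0m; have mt := @measurable_trunc R n.
have it2 : m.-integrable setT (EFin \o (fun x => trunc n x ^+ 2)).
  apply: (@bounded_integrable _ _ _ _ _ (n%:R ^+ 2)) => [|x].
    exact: measurable_funX.
  by rewrite normrX ler_sqr ?nnegrE ?normr_ge0 ?trunc_norm_le.
rewrite -lee_fin /Rintegral fineK; last exact: integrable_fin_num.
apply: (@le_trans _ _ (\int[m]_x
    \sum_(k < n) ((2 * k%:R + 1) * \1_[set y : R | k%:R <= `|y|] x)%:E)%E).
  apply: ge0_le_integral_pointwise => x; first by rewrite lee_fin sqr_ge0.
  rewrite sumEFin lee_fin (le_trans (trunc_sq_le _ _))//.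
  apply: ler_sum => k _; rewrite indicE.
  by case: ifPn => h; [rewrite mem_set|rewrite memNset//; exact/negP].
rewrite ge0_integral_sum//; last first.
  by move=> k; apply/measurable_EFinP; apply: measurable_funM => //;
    apply: measurable_indic; exact: measurable_norm_ge.
rewrite /moment_bound -sumEFin; apply: lee_sum => k _.
under eq_integral do rewrite EFinM.
rewrite ge0_integralZl_EFin//; last first.
  by apply/measurable_EFinP; apply: measurable_indic; exact: measurable_norm_ge.
rewrite integral_indic//; last exact: measurable_norm_ge.
rewrite setIT EFinM lee_wpmul2l//; exact: tail_capacity_ge.
Qed.

(** To be used with Q0 = P0 for estimates over the whole family, and with Q0 a
    single law for the concentration of one product measure. *)
Lemma weak_law_deviation (Q0 : set (probability R R)) a b eps n P :
  Q0 `<=` P0 ->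
  (forall m : probability R R, Q0 m -> a <= \int[m]_x trunc n x <= b) ->
  0 < eps -> (0 < n)%N -> iid_family Q0 P ->
  (P [set omega | ~~ (a - eps <= sample_mean n omega <= b + eps)%R] <=
   (deviation_bound eps n)%:E)%E.
Proof.
move=> Q0P0; case: n => // n mab eps0 _ PQ.
apply: (weak_law_bound (P0 := Q0)) => //.
- exact: tail_capacity_ge0.
- exact: moment_bound_ge0.
- by move=> m /Q0P0; exact: tail_capacity_ge.
- by move=> m /Q0P0; exact: second_moment_le.
Qed.

Hypothesis tail : (fun n : nat =>
  (n%:R%:E * upper_capacity (iid_family P0)
               [set omega | (n%:R <= `|X 0 omega|)%R])%E) @ \oo --> 0%E.

Let cvg_tail : n%:R * tail_capacity n @[n --> \oo] --> (0 : R).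
Proof.
move/fine_cvgP : tail => [_].
apply: cvg_trans; apply: near_eq_cvg; apply: nearW => n /=.
by rewrite tail_capacityE.
Qed.

(** Both terms are governed by k V_k --> 0, the second one as the Cesaro mean of
    (2 k + 1) V_k. *)
Lemma cvg_deviation_bound eps : 0 < eps ->
  deviation_bound eps n @[n --> \oo] --> (0 : R).
Proof.
move=> eps0.
have cvg_u : (2 * k%:R + 1) * tail_capacity k @[k --> \oo] --> (0 : R).
  rewrite -(cvg_shiftS (fun k => (2 * k%:R + 1) * tail_capacity k)).
  apply: (@squeeze_cvgr _ _ _ _ (cst 0) (fun k => 3 * (k.+1%:R * tail_capacity k.+1))).
  - have key (x y : R) : 1 <= x -> 0 <= y -> 0 <= (2 * x + 1) * y <= 3 * (x * y).
      by move=> x1 y0; rewrite mulr_ge0//= ?mulrA ?ler_wpM2r//; lra.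
    by apply: nearW => k; apply: key; [rewrite ler1n|exact: tail_capacity_ge0].
  - exact: cvg_cst.
  - rewrite -[X in _ --> X](mulr0 3); apply: cvgMr.
    by rewrite (cvg_shiftS (fun k => k%:R * tail_capacity k)).
rewrite -(cvg_shiftS (deviation_bound eps)).
suff : deviation_bound eps n.+1 @[n --> \oo] --> (0 + 0 : R) by rewrite addr0.
apply: cvgD; first by rewrite (cvg_shiftS (fun n => n%:R * tail_capacity n)).
suff : moment_bound n.+1 / (n.+1%:R * eps ^+ 2) @[n --> \oo] -->
    (0 * (eps ^+ 2)^-1 : R) by rewrite mul0r.
have -> : (fun n => moment_bound n.+1 / (n.+1%:R * eps ^+ 2)) =
    (fun n => arithmetic_mean (fun k => (2 * k%:R + 1) * tail_capacity k) n *
              (eps ^+ 2)^-1).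
  apply/funext => n; rewrite /moment_bound /arithmetic_mean /series/= big_mkord.
  by rewrite invfM; ring.
by apply: cvgMl; exact: cesaro.
Qed.

End tails.

(** * The sample mean under the family *)

Lemma measurable_sample_mean (R : realType) n :
  measurable_fun setT (@sample_mean R n).
Proof.
apply: measurable_funM => //; apply: measurable_sum => i; exact: measurable_X.
Qed.

Lemma Rintegral_le_off_event d (T : measurableType d) (R : realType)
    (P : probability T R) (Y : T -> R) (B : set T) (M c D p : R) :
  measurable_fun setT Y -> (forall t, `|Y t| <= M) -> measurable B -> 0 <= D ->
  (P B <= p%:E)%E -> (forall t, Y t <= c + D * \1_B t) ->
  \int[P]_t Y t <= c + D * p.
Proof.
move=> mY YM mB D0 PB YB; have iY := bounded_integrable P mY YM.
have iB : P.-integrable setT (EFin \o \1_B).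
  apply: (@bounded_integrable _ _ _ P _ 1); first exact: measurable_indic.
  by move=> t; rewrite indicE; case: (_ \in _); rewrite ?normr1 ?normr0.
have iDB : P.-integrable setT (EFin \o (fun t => D * \1_B t)).
  by have := integrableZl measurableT D iB.
have ic : P.-integrable setT (EFin \o cst c).
  by apply: (@bounded_integrable _ _ _ P _ `|c|).
have icDB : P.-integrable setT (EFin \o (fun t => c + D * \1_B t)).
  by have := integrableD measurableT ic iDB.
apply: le_trans (le_Rintegral measurableT iY icDB (fun t _ => YB t)) _.
rewrite (RintegralD measurableT ic iDB) Rintegral_prob_cst RintegralZl//.
rewrite lerD2l ler_wpM2l//.
rewrite -lee_fin /Rintegral fineK; last exact: integrable_fin_num.
by rewrite integral_indic// setIT.
Qed.

Section main.
Variables (R : realType) (P0 : set (probability R R)).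
Hypotheses (P0_neq0 : P0 !=set0) (P0_convex : convex_probabilities P0).

Let lo := lower_mean (iid_family P0).
Let up := upper_mean (iid_family P0).

Lemma measurable_sample_mean_itv n (a b : R) :
  measurable [set omega : RN R | a <= sample_mean n omega <= b].
Proof.
rewrite (_ : mkset _ = @sample_mean R n @^-1` `[a, b]%classic).
  by rewrite -[X in measurable X]setTI; exact: measurable_sample_mean.
by apply/seteqP; split => omega /=; rewrite in_itv.
Qed.

Lemma lower_capacity_sample_mean eps n : 0 < eps -> (0 < n)%N ->
  ((1 - deviation_bound P0 eps n)%:E <= lower_capacity (iid_family P0)
       [set omega | (lo n - eps <= sample_mean n omega <= up n + eps)%R] <= 1)%E.
Proof.
move=> eps0 n0; have [m0 /exists_iid_X0[P1 PP1 _]] := P0_neq0.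
have mA := measurable_sample_mean_itv n (lo n - eps) (up n + eps).
apply/andP; split; last first.
  apply: (@le_trans _ _ (P1
      [set omega | (lo n - eps <= sample_mean n omega <= up n + eps)%R])).
    by apply: ereal_inf_lbound; exists P1.
  exact: probability_le1.
apply: le_ereal_inf_tmp => _ [P PP <-].
have := weak_law_deviation P0_neq0 (@subset_refl _ P0)
  (trunc_mean_bounds P0_neq0 n) eps0 n0 PP.
rewrite (_ : mkset _ = ~` [set omega | lo n - eps <= sample_mean n omega <= up n + eps]);
  last by apply/seteqP; split => omega /= /negP.
rewrite probability_setC// -[X in (1 - X <= _)%E]fineK ?fin_num_measure//.
by rewrite -EFinD lee_fin -[X in (_ <= X)%E]fineK ?fin_num_measure// lee_fin; lra.
Qed.

Section second_part.
Variables (phi : R -> R) (F : R).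
Hypotheses (cphi : continuous phi) (phiF : forall x, `|phi x| <= F).

Let mphi n : measurable_fun setT (fun omega : RN R => phi (sample_mean n omega)).
Proof.
apply: measurableT_comp; last exact: measurable_sample_mean.
exact: continuous_measurable_fun.
Qed.

Let expectationE (P : probability (RN R) R) n :
  ('E_P[(fun omega => phi (sample_mean n omega))] =
   (\int[P]_omega phi (sample_mean n omega))%:E)%E.
Proof.
rewrite unlock /Rintegral fineK// integrable_fin_num//.
exact: bounded_integrable (mphi n) (fun omega => phiF _).
Qed.

Variables (n : nat) (M eta d : R).
Hypotheses (n0 : (0 < n)%N) (d0 : 0 < d) (eta0 : 0 <= eta).
Hypothesis M_max : is_maximum [set phi mu | mu in `[lo n, up n]] M.
Hypothesis phi_close : forall x y, lo n <= x <= up n -> `|x - y| <= d ->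
  `|phi x - phi y| <= eta.

Let F0 : 0 <= F. Proof. exact: le_trans (phiF 0). Qed.

Let M_le_norm : `|M| <= F.
Proof. by have [[x _ <-] _] := M_max. Qed.

(** When the sample mean is within d of the mean interval, phi exceeds M by at
    most eta; otherwise by at most 2 F. *)
Lemma sublinear_expectation_le :
  (sublinear_expectation (iid_family P0) (fun omega => phi (sample_mean n omega)) <=
   (M + eta + 2 * F * deviation_bound P0 d n)%:E)%E.
Proof.
apply: ge_ereal_sup => _ [P PP <-]; rewrite expectationE lee_fin.
have mA := measurable_sample_mean_itv n (lo n - d) (up n + d).
have PB := weak_law_deviation P0_neq0 (@subset_refl _ P0)
  (trunc_mean_bounds P0_neq0 n) d0 n0 PP.
rewrite (_ : mkset _ = ~` [set omega | lo n - d <= sample_mean n omega <= up n + d]) in PB;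
  last by apply/seteqP; split => omega /= /negP.
apply: (Rintegral_le_off_event (mphi n) (fun omega => phiF _) (measurableC mA) _ PB).
  by rewrite mulr_ge0.
move=> omega; rewrite indicE.
have [_|omegaA] := boolP (omega \in ~` _).
  rewrite mulr1; have := phiF (sample_mean n omega); have := M_le_norm.
  rewrite !ler_norml; move: eta0; lra.
rewrite mulr0 addr0; move: omegaA; rewrite notin_setE /= => /contrapT /andP[ls su].
have [y yI sy] : exists2 y, lo n <= y <= up n & `|y - sample_mean n omega| <= d.
  have lu := lower_le_upper_mean P0_neq0 n; rewrite -/(lo n) -/(up n) in lu.
  have [h|h] := leP (sample_mean n omega) (lo n).
    by exists (lo n); rewrite ?lexx ?lu// ler_norml; lra.
  have [h'|h'] := leP (up n) (sample_mean n omega).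
    by exists (up n); rewrite ?lexx ?lu// ler_norml; lra.
  by exists (sample_mean n omega); rewrite ?subrr ?normr0 ?ltW// h h'.
have := phi_close yI sy.
have : phi y <= M by have [_] := M_max; apply; exists y => //; rewrite /= in_itv.
by rewrite ler_norml; lra.
Qed.

(** Half of d is spent on approximating a maximizer of phi by the truncated mean
    of a law in P0, the other half on the deviation of the sample mean under the
    product measure with that law. *)
Lemma sublinear_expectation_ge :
  ((M - eta - 2 * F * deviation_bound P0 (d / 2) n)%:E <=
   sublinear_expectation (iid_family P0) (fun omega => phi (sample_mean n omega)))%E.
Proof.
have d2 : 0 < d / 2 by rewrite divr_gt0.
have [[c /= cI phic] _] := M_max; rewrite in_itv/= in cI.
have [m P0m mc] := exists_trunc_mean P0_neq0 P0_convex d2 cI.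
have [P Pm] := iid_family_singleton_neq0 m.
have mP0 : [set m] `<=` P0 by move=> _ ->.
set e := (\int[m]_x trunc n x) in mc.
have mab (m' : probability R R) : [set m] m' -> e <= \int[m']_x trunc n x <= e.
  by move=> ->; rewrite lexx.
have mA := measurable_sample_mean_itv n (e - d / 2) (e + d / 2).
have PB := weak_law_deviation P0_neq0 mP0 mab d2 n0 Pm.
rewrite (_ : mkset _ =
    ~` [set omega | e - d / 2 <= sample_mean n omega <= e + d / 2]) in PB;
  last by apply/seteqP; split => omega /= /negP.
apply: (@le_trans _ _ (\int[P]_omega phi (sample_mean n omega))%:E); last first.
  rewrite -expectationE; apply: ereal_sup_ubound; exists P => //.
  exact: iid_family_sub Pm.
rewrite lee_fin.
have : \int[P]_omega (- phi (sample_mean n omega)) <=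
    (- M + eta) + 2 * F * deviation_bound P0 (d / 2) n.
  apply: (Rintegral_le_off_event _ _ (measurableC mA) _ PB).
  - by apply: measurableT_comp; [exact: oppr_measurable|exact: mphi].
  - by move=> omega; rewrite normrN; exact: phiF.
  - by rewrite mulr_ge0.
  move=> omega; rewrite indicE.
  have [_|omegaA] := boolP (omega \in ~` _).
    rewrite mulr1; have := phiF (sample_mean n omega); have := M_le_norm.
  rewrite !ler_norml; move: eta0; lra.
  rewrite mulr0 addr0; move: omegaA; rewrite notin_setE /= => /contrapT /andP[ls su].
  have cs : `|c - sample_mean n omega| <= d by move: mc; rewrite !ler_norml; lra.
  by have := phi_close cI cs; rewrite phic ler_norml; lra.
have -> : \int[P]_omega (- phi (sample_mean n omega)) =
    - \int[P]_omega phi (sample_mean n omega).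
  rewrite -[RHS]mulN1r -RintegralZl//.
    by apply: eq_Rintegral => omega _; rewrite mulN1r.
  exact: bounded_integrable (mphi n) (fun omega => phiF _).
lra.
Qed.

End second_part.

End main.

(** * The weak law of large numbers *)

Unset Implicit Arguments.
Theorem theorem3p1 (R : realType) (P0 : set (probability R R))
    (P0_neq0 : P0 !=set0)
    (P0_convex : convex_probabilities P0)
    (P0_compact : weakly_compact P0)
    (tail : (fun n : nat =>
       (n%:R%:E * upper_capacity (iid_family P0)
                    [set omega | (n%:R <= `|X 0 omega|)%R])%E) @ \oo --> 0%E) :
  (forall eps : R, 0 < eps ->
    (fun n : nat => lower_capacity (iid_family P0)
       [set omega | lower_mean (iid_family P0) n - eps <= sample_mean n omega
                      <= upper_mean (iid_family P0) n + eps]) @ \oo --> 1%E)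
  /\
  (bounded_fun (lower_mean (iid_family P0)) ->
   bounded_fun (upper_mean (iid_family P0)) ->
   forall phi : R -> R, continuous phi -> bounded_fun phi ->
   exists2 M : nat -> R,
     (forall n : nat, (0 < n)%N ->
        is_maximum [set phi mu | mu in
          `[lower_mean (iid_family P0) n, upper_mean (iid_family P0) n]] (M n)) &
     (fun n : nat =>
        `|sublinear_expectation (iid_family P0)
            (fun omega => phi (sample_mean n omega)) - (M n)%:E|%E)
       @ \oo --> 0%E).
Proof.
have dev0 (eps e : R) : 0 < eps -> 0 < e -> \forall n \near \oo,
    (0 < n)%N /\ deviation_bound P0 eps n <= e.
  move=> eps0 e0.
  exact: filterS2 (nbhs_infty_gt 0)
    (cvgr_le _ (cvg_deviation_bound P0_neq0 tail eps0) e e0).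
split=> [eps eps0|].
  apply: near_le_cvge => e e0; apply: filterS (dev0 eps e eps0 e0) => n [n0 de].
  have /andP[l u] := lower_capacity_sample_mean P0_neq0 eps0 n0.
  rewrite (le_trans _ l) ?lee_fin ?lerB//=.
  by apply: (le_trans u); rewrite lee_fin lerDl ltW.
have bounded_by T (f : T -> R) : bounded_fun f -> exists B : R, forall x, `|f x| <= B.
  by move=> [B [_ fB]]; exists (B + 1) => x; apply: fB; rewrite ?ltrDl.
move=> /bounded_by[B1 loB] /bounded_by[B2 upB] phi cphi /bounded_by[F phiF].
have F0 : 0 <= F by exact: le_trans (phiF 0).
have /choice[M Mmax] (n : nat) : exists M, is_maximum [set phi mu | mu in
    `[lower_mean (iid_family P0) n, upper_mean (iid_family P0) n]] M.
  have [c cI cmax] := EVT_max (lower_le_upper_mean P0_neq0 n)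
    (continuous_subspaceT cphi).
  by exists (phi c); split => [|_ [t tI <-]]; [exists c|exact: cmax].
exists M => //; apply: near_le_cvge => e e0.
have e2 : 0 < e / 2 by rewrite divr_gt0.
have [d d0 dP] := segment_unif_continuous (- B1) B2 cphi e2.
have d2 : 0 < d / 2 by rewrite divr_gt0.
(* Chosen so that 2 F e' is at most e / 2, also when F = 0. *)
pose e' := e / 2 / (2 * F + 1).
have e'0 : 0 < e' by rewrite divr_gt0// ltr_wpDl// mulr_ge0.
have Fe' : 2 * F * e' <= e / 2.
  rewrite /e' mulrCA ger_pMr// ler_pdivrMr ?mul1r; first by rewrite lerDl.
  by rewrite ltr_wpDl// mulr_ge0.
apply: filterS2 (dev0 d e' d0 e'0) (dev0 _ e' d2 e'0) => n [n0 n1] [_ n2].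
have close x y : lower_mean (iid_family P0) n <= x <= upper_mean (iid_family P0) n ->
    `|x - y| <= d -> `|phi x - phi y| <= e / 2.
  move=> /andP[lx xu]; apply: dP; have := loB n; have := upB n.
  by rewrite !ler_norml; lra.
have hu := sublinear_expectation_le P0_neq0 cphi phiF n0 d0 (ltW e2) (Mmax n) close.
have hl := sublinear_expectation_ge P0_neq0 P0_convex cphi phiF n0 d0 (ltW e2)
  (Mmax n) close.
set E := sublinear_expectation _ _ in hu hl *.
have Efin : E \is a fin_num.
  by rewrite fin_numElt (lt_le_trans (ltNyr _) hl) (le_lt_trans hu (ltry _)).
move: Efin hu hl; case: E => [v|//|//] _; rewrite !lee_fin => hu hl.
rewrite sub0r add0r; apply/andP; split.
  by rewrite (le_trans _ (normr_ge0 _))// oppr_le0 ltW.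
have F20 : 0 <= 2 * F by rewrite mulr_ge0.
have F1 := ler_wpM2l F20 n1.
have F2 := ler_wpM2l F20 n2.
by rewrite ler_norml; lra.
Qed.
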